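(* There is an algorithm that, given an instance $(G,T,\gamma,\alpha)$ of the $t$-Dimensional Parity Join Problem with $n$ vertices and $m$ edges and with $|T|\le 2$, finds the optimal value in time $O(mn)$.
   Context: The $t$-Dimensional Parity Join Problem ($t$ a fixed non-negative integer): an instance is a tuple $(G,T,\gamma,\alpha)$ with $G$ a graph, $T\subseteq V(G)$, $\gamma:E(G)\to\mathrm{GF}(2)^t$, $\alpha\in\mathrm{GF}(2)^t$; the problem is to find a minimum-size $T$-join $J$ of $G$ with $\gamma(J)=\sum_{e\in J}\gamma(e)=\alpha$. A $T$-join is a set $J\subseteq E(G)$ such that $T$ is exactly the set of odd-degree vertices of the spanning subgraph $(V(G),J)$. The optimal value is the minimum size of such a $J$ ($\infty$ if none exists). *)

(* Defs.v *)
From mathcomp Require Import all_boot all_order all_algebra.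

Set Implicit Arguments.
Unset Strict Implicit.
Unset Printing Implicit Defensive.

Import GRing.Theory.
Local Open Scope nat_scope.

(* Graphs are finite undirected multigraphs; loops and parallel edges are
   allowed. The order of the two components of [ends e] carries no meaning. *)
Record instance (t n m : nat) := Instance {
  ends : 'I_m -> 'I_n * 'I_n;
  terminals : {set 'I_n};
  label : 'I_m -> 'rV['F_2]_t;
  target : 'rV['F_2]_t
}.

Section ParityJoin.

Variables (t n m : nat) (I : instance t n m).

(* A loop contributes 2 to the degree of its end. *)
Definition degree (J : {set 'I_m}) (v : 'I_n) : nat :=
  \sum_(e in J) (((ends I e).1 == v) + ((ends I e).2 == v)).

Definition is_join (J : {set 'I_m}) : bool :=
  terminals I == [set v | odd (degree J v)].

Definition feasible (J : {set 'I_m}) : bool :=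
  is_join J && ((\sum_(e in J) label I e)%R == target I).

(* [None] stands for infinity. *)
Definition opt_value : option nat :=
  if [pick J | feasible J] is Some J0
  then Some #|[arg min_(J < J0 | feasible J) #|J| ]|
  else None.

End ParityJoin.

(* Word RAM, presented as a structured language: a program manipulates finitely
   many arrays (named by numerals) of w-bit words, indexed by words; a scalar
   variable is cell 0 of an array. Each constant, memory read, arithmetic
   operation, test and memory write takes one unit of time. *)

Inductive expr :=
| Const of nat
| Read of nat & expr
| Add of expr & expr
| Sub of expr & expr.

Inductive cmd :=
| Skip
| Write of nat & expr & expr
| Seq of cmd & cmd
| If of expr & cmd & cmd
| While of expr & cmd.

Definition memory := nat -> nat -> nat.

Definition update (s : memory) (a i v : nat) : memory :=
  fun b j => if (b == a) && (j == i) then v else s b j.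

(* Addition wraps around modulo 2 ^ w; subtraction is truncated at 0, so that
   it also serves as a comparison. *)
Fixpoint eval (w : nat) (s : memory) (e : expr) : nat :=
  match e with
  | Const k => k %% 2 ^ w
  | Read a i => s a (eval w s i)
  | Add e1 e2 => (eval w s e1 + eval w s e2) %% 2 ^ w
  | Sub e1 e2 => eval w s e1 - eval w s e2
  end.

Fixpoint cost (e : expr) : nat :=
  match e with
  | Const _ => 1
  | Read _ i => (cost i).+1
  | Add e1 e2 | Sub e1 e2 => (cost e1 + cost e2).+1
  end.

(* [exec w c s k s']: on w-bit words, [c] started in memory [s] halts after
   [k] units of time in memory [s']. *)
Inductive exec (w : nat) : cmd -> memory -> nat -> memory -> Prop :=
| ExecSkip s :
    exec w Skip s 1 s
| ExecWrite a i e s :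
    exec w (Write a i e) s (cost i + cost e).+1
      (update s a (eval w s i) (eval w s e))
| ExecSeq c1 c2 s1 s2 s3 k1 k2 :
    exec w c1 s1 k1 s2 -> exec w c2 s2 k2 s3 ->
    exec w (Seq c1 c2) s1 (k1 + k2) s3
| ExecIfTrue e c1 c2 s s' k :
    eval w s e != 0 -> exec w c1 s k s' ->
    exec w (If e c1 c2) s (cost e + k).+1 s'
| ExecIfFalse e c1 c2 s s' k :
    eval w s e = 0 -> exec w c2 s k s' ->
    exec w (If e c1 c2) s (cost e + k).+1 s'
| ExecWhileTrue e c s1 s2 s3 k1 k2 :
    eval w s1 e != 0 -> exec w c s1 k1 s2 -> exec w (While e c) s2 k2 s3 ->
    exec w (While e c) s1 (cost e + k1 + k2).+1 s3
| ExecWhileFalse e c s :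
    eval w s e = 0 -> exec w (While e c) s (cost e).+1 s.

Definition encode_vector (t : nat) (x : 'rV['F_2]_t) : seq nat :=
  [seq nat_of_ord (x ord0 i) | i <- enum 'I_t].

(* The graph is given by its list of edges, each followed by its label. *)
Definition encode (t n m : nat) (I : instance t n m) : seq nat :=
  [:: n; m; #|terminals I|]
  ++ [seq nat_of_ord v | v <- enum (terminals I)]
  ++ encode_vector (target I)
  ++ flatten [seq [:: nat_of_ord (ends I e).1; nat_of_ord (ends I e).2]
                  ++ encode_vector (label I e) | e <- enum 'I_m].

(* The input is in array 0; all other cells are initially 0. *)
Definition initial (input : seq nat) : memory :=
  fun a i => if a == 0 then nth 0 input i else 0.

(* The output is in cell 0 of array 1; 0 encodes infinity, k + 1 encodes k. *)
Definition output (s : memory) : option nat :=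
  if s 1 0 is k.+1 then Some k else None.

(* Main.v *)
(* A T-join with |T| <= 2 splits into a path between the two terminals and closed
   trails, so only the labels and lengths of these pieces matter. A breadth-first
   search from (v, 0) in the cover of the graph with vertices (u, g), g in
   GF(2)^t, in which an edge xy with label d joins (x, g) to (y, g + d), finds for
   every g the shortest walk with label g from v to any vertex; since t is fixed,
   it takes time O(m + 1), as it reaches no isolated vertex other than v. Conversely the
   edges used an odd number of times by a closed walk form an even subgraph with
   the same label. Hence n + 1 searches yield, for each g, the minimal length p(g)
   of a walk between the terminals and c(g) of a closed walk, and the optimum is
   the closure of p under p(g) := min (p(g), p(g + d) + c(d)), reached by letting d
   run once through GF(2)^t. *)
From HB Require Import structures.
Require Import Defs.
From mathcomp Require Import all_boot all_order all_algebra zify.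

Set Implicit Arguments.
Unset Strict Implicit.
Unset Printing Implicit Defensive.

Import GRing.Theory.

(** The bound leaves no time proportional to n for each single search, since m may be much smaller
    than n. Hence the distance table is never cleared as a whole: after a search only the entries of
    the queued states are reset, and the queue has at most one state more than the cover has arcs.
    The reset table must agree with the initial memory, so a length is stored as [big] minus the
    length, with 0 for unreachable; minima become maxima, which truncated subtraction computes as a
    + (b - a). Correctness is proved without shortest walks. Soundness: a positive entry is
    witnessed by an edge set with the right parities and label. Completeness: entries drop by at
    most 1 along each edge of the cover, so a trail inside a given join bounds the entry at its end
    from below. One pass over the labels suffices because relaxing by d keeps the closure under the
    labels treated before. *)

(** * Parities and labels of edge sets *)

(* Sealing the type of labels and its addition keeps arithmetic terms over tables
   indexed by labels syntactically comparable. *)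
Definition lab (t : nat) : finType := 'rV['F_2]_t.
Definition gzero {t} : lab t := (0 : 'rV['F_2]_t)%R.
Definition gadd t (x y : lab t) : lab t := ((x : 'rV['F_2]_t) + y)%R.
Definition elab t n m (I : instance t n m) (e : 'I_m) : lab t := label I e.

Local Notation "x +v y" := (gadd x y) (at level 50, left associativity).

Section Labels.

Variable t : nat.
Implicit Types x y z : lab t.

Lemma gaddA : associative (@gadd t).
Proof. by move=> x y z; exact: addrA. Qed.

Lemma gaddC : commutative (@gadd t).
Proof. by move=> x y; exact: addrC. Qed.

Lemma gadd0 : right_id gzero (@gadd t).
Proof. by move=> x; exact: addr0. Qed.

Lemma gadd0r : left_id gzero (@gadd t).
Proof. by move=> x; exact: add0r. Qed.

HB.instance Definition _ := Monoid.isComLaw.Build (lab t) gzero (@gadd t) gaddA gaddC gadd0r.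

Lemma gaddvv x : x +v x = gzero.
Proof. by apply/rowP => i; rewrite !mxE addrr_pchar2 // pchar_Fp. Qed.

Lemma gaddvK x y : x +v y +v y = x.
Proof. by rewrite -gaddA gaddvv gadd0. Qed.

End Labels.

Section Joins.

Variables (t n m : nat) (I : instance t n m).
Notation G := (lab t).

Definition symdiff (A B : {set 'I_m}) := [set e | (e \in A) (+) (e \in B)].

(** An edge in both sets contributes twice, hence nothing. This one fact serves degree parities
    ([addb]) and labels ([gadd]) alike. *)
Lemma big_symdiff (R : Type) (idx : R) (op : Monoid.com_law idx) (A B : {set 'I_m})
    (f : 'I_m -> R) :
  (forall x, op x x = idx) ->
  \big[op/idx]_(e in symdiff A B) f e =
  op (\big[op/idx]_(e in A) f e) (\big[op/idx]_(e in B) f e).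
Proof.
move=> opxx; rewrite big_mkcond [X in op X _]big_mkcond [X in op _ X]big_mkcond -big_split.
apply: eq_bigr => e _ /=.
rewrite inE; case: (e \in A); case: (e \in B) => /=;
  by rewrite ?opxx ?Monoid.mulm1 ?Monoid.mul1m.
Qed.

Lemma card_symdiff A B : #|symdiff A B| <= #|A| + #|B|.
Proof.
rewrite -!sum1_card big_mkcond [X in X + _]big_mkcond [X in _ + X]big_mkcond.
rewrite -big_split /=; apply: leq_sum => e _.
by rewrite inE; case: (e \in A); case: (e \in B).
Qed.

Definition weight (J : {set 'I_m}) : G := \big[@gadd t/gzero]_(e in J) elab I e.

Definition par (J : {set 'I_m}) (v : 'I_n) : bool := odd (degree I J v).

Definition endpar (e : 'I_m) (v : 'I_n) : bool :=
  ((ends I e).1 == v) (+) ((ends I e).2 == v).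

Lemma parE J v : par J v = \big[addb/false]_(e in J) endpar e v.
Proof.
rewrite /par /degree (big_morph odd oddD (erefl _)).
by apply: eq_bigr => e _; rewrite oddD !oddb.
Qed.

Lemma par_symdiff A B v : par (symdiff A B) v = par A v (+) par B v.
Proof. by rewrite !parE; apply: big_symdiff => -[]. Qed.

Lemma weight_symdiff A B : weight (symdiff A B) = weight A +v weight B.
Proof. by apply: big_symdiff => x; apply: gaddvv. Qed.

Lemma par1 e v : par [set e] v = endpar e v.
Proof. by rewrite parE big_set1. Qed.

Lemma par0 v : par set0 v = false.
Proof. by rewrite parE big_set0. Qed.

Lemma weight0 : weight set0 = gzero.
Proof. by rewrite /weight big_set0. Qed.

Lemma weight1 e : weight [set e] = elab I e.
Proof. by rewrite /weight big_set1. Qed.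

Lemma symdiff_sub (A B : {set 'I_m}) : A \subset B -> symdiff B A = B :\: A.
Proof.
move=> /subsetP sAB; apply/setP => e; rewrite !inE.
by case: (boolP (e \in A)) => [/sAB -> | _]; rewrite ?addbF.
Qed.

Lemma parD (A B : {set 'I_m}) v : A \subset B -> par (B :\: A) v = par B v (+) par A v.
Proof. by move=> sAB; rewrite -symdiff_sub // par_symdiff. Qed.

Lemma weightD (A B : {set 'I_m}) : A \subset B -> weight (B :\: A) = weight B +v weight A.
Proof. by move=> sAB; rewrite -symdiff_sub // weight_symdiff. Qed.

(** Handshake lemma: after exchanging the sums, each edge contributes both of its ends. It will
    exclude a single terminal. *)
Lemma even_card_odd (J : {set 'I_m}) : odd #|[set v | par J v]| = false.
Proof.
rewrite -sum1_card (big_morph odd oddD (erefl _)) big_mkcond /=.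
rewrite (eq_bigr (fun v => \big[addb/false]_(e in J) endpar e v)); last first.
  by move=> v _; rewrite inE -parE; case: (par J v).
rewrite exchange_big big1 // => e _ /=.
rewrite big_split /=.
have h (x : 'I_n) : \big[addb/false]_v (x == v) = true.
  rewrite (bigD1 x) //= eqxx big1 // => v /negbTE; by rewrite eq_sym.
by rewrite !h.
Qed.

Lemma is_joinP J : reflect (forall v, par J v = (v \in terminals I)) (is_join I J).
Proof.
apply: (iffP eqP) => [-> v | h]; first by rewrite inE.
by apply/setP => v; rewrite inE -h.
Qed.

(** * Tables over the cover, and decomposition of joins into trails *)

Definition adj (e : 'I_m) (x y : 'I_n) := (ends I e == (x, y)) || (ends I e == (y, x)).

Lemma adj_endpar e x y v : adj e x y -> endpar e v = (v == x) (+) (v == y).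
Proof. by rewrite /endpar => /orP[] /eqP -> /=; rewrite !(eq_sym v) // addbC. Qed.

Variable big : nat.

(* The entries of the tables computed below are [big] minus a length, so that
   [0] is the value of an unreachable entry and larger means shorter. *)
Definition realizes (b : 'I_n -> bool) (x : G) (z : nat) : Prop :=
  exists J : {set 'I_m}, [/\ par J =1 b, weight J = x & #|J| + z <= big].

Lemma eq_realizes b1 b2 x z : b1 =1 b2 -> realizes b1 x z -> realizes b2 x z.
Proof. by move=> eqb [J [pJ wJ cJ]]; exists J; split=> // v; rewrite pJ eqb. Qed.

(** Lengths add up: (big - z1) + (big - z2) = big - (z1 + z2 - big). Edges common to both sets
    cancel, which only shortens the result. *)
Lemma realizes_add b1 b2 x1 x2 z1 z2 :
  big < z1 + z2 -> realizes b1 x1 z1 -> realizes b2 x2 z2 ->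
  realizes (fun v => b1 v (+) b2 v) (x1 +v x2) (z1 + z2 - big).
Proof.
move=> lt_z [J1 [p1 w1 c1]] [J2 [p2 w2 c2]]; exists (symdiff J1 J2).
split=> [v | |]; first by rewrite par_symdiff p1 p2.
  by rewrite weight_symdiff w1 w2.
by have := card_symdiff J1 J2; lia.
Qed.

Lemma realizes_refl x : realizes (fun v => (v == x) (+) (v == x)) gzero big.
Proof. by exists set0; split=> [v | |]; rewrite ?par0 ?addbb ?weight0 ?cards0. Qed.

Lemma realizes_step x y y' g e z :
  adj e y y' -> 0 < z -> realizes (fun v => (v == x) (+) (v == y)) g z ->
  realizes (fun v => (v == x) (+) (v == y')) (g +v elab I e) z.-1.
Proof.
move=> eyy' z_gt0 [J [pJ wJ cJ]]; exists (symdiff J [set e]); split=> [v | |].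
- rewrite par_symdiff par1 pJ (adj_endpar _ eyy').
  by rewrite -addbA; congr addb; rewrite addbA addbb.
- by rewrite weight_symdiff weight1 wJ.
- by have := card_symdiff J [set e]; rewrite cards1; lia.
Qed.

(** The feasible-potential inequality of shortest paths along one edge of the cover, written for
    [big] minus a distance. *)
Definition closed_table (D : 'I_n -> G -> nat) :=
  forall e x y g, adj e x y -> D x g <= (D y (g +v elab I e)).+1.

(** Walk from [x] inside [J], deleting each edge used. As long as the current vertex differs from
    [y], it has odd degree in what remains, so the walk can go on; on arrival at [y] the remainder
    is even. By [closed_table] each edge costs at most 1. *)
Lemma trail (D : 'I_n -> G -> nat) (J : {set 'I_m}) x y g :
  closed_table D -> par J =1 (fun v => (v == x) (+) (v == y)) ->
  exists P : {set 'I_m}, [/\ P \subset J, par (J :\: P) =1 xpred0 &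
    D x g <= D y (g +v weight P) + #|P|].
Proof.
move=> clD; have [k] := ubnP #|J|; elim: k J x g => // k IHk J x g leJ pJ.
have [eqxy | neqxy] := eqVneq x y.
  exists set0; rewrite sub0set weight0 gadd0 cards0 addn0 eqxy; split=> // v.
  by rewrite setD0 pJ eqxy addbb.
have [e eJ ex] : exists2 e, e \in J & endpar e x.
  apply/exists_inP; have := pJ x; rewrite eqxx (negbTE neqxy) /= parE => pJx.
  apply: contraTT isT => /exists_inPn noe.
  by move: pJx; rewrite big1 // => e /noe /negbTE.
have [z exz] : exists z, adj e x z.
  move: ex; rewrite /endpar /adj; case: (ends I e) => u v /=.
  have [<- _ | _ /= /eqP <-] := eqVneq u x; first by exists v; rewrite eqxx.
  by exists u; rewrite eqxx orbT.
have seJ : [set e] \subset J by rewrite sub1set.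
have cJ : #|J| = #|J :\: [set e]|.+1 by rewrite (cardsD1 e) eJ.
have [||P [sP pP leP]] := IHk (J :\: [set e]) z (g +v elab I e).
- by rewrite -ltnS -cJ.
- move=> v; rewrite parD // pJ par1 (adj_endpar _ exz).
  by case: (v == x); case: (v == y); case: (v == z).
have eP : e \notin P by apply/negP => /(subsetP sP); rewrite !inE eqxx.
exists (e |: P); split.
- rewrite subUset seJ; exact: subset_trans sP (subsetDl _ _).
- by move=> v; rewrite -(pP v) setDDl.
- have wP : weight (e |: P) = elab I e +v weight P by rewrite /weight big_setU1.
  rewrite wP gaddA cardsU1 eP; have := clD e x z g exz; move: leP => /=.
  have arith (a b c d : nat) : a <= c + d -> b <= a.+1 -> b <= c + (1 + d) by lia.
  exact: arith.
Qed.

(** What is needed of a search from [x]: the first two clauses bound the entries from below, the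
    last one bounds them from above. *)
Definition good_table (x : 'I_n) (D : 'I_n -> G -> nat) :=
  [/\ D x gzero = big, closed_table D &
     forall y g, 0 < D y g -> realizes (fun v => (v == x) (+) (v == y)) g (D y g)].

(** Peel off a closed trail, made of an edge xy of [J] and a trail [P] back from y to x. At the
    label d of this trail the search from x has an entry of at least [big] - (#|P| + 1), hence so
    has [C]. The closure of [F] under d pays for the trail, and induction for the rest of [J]. *)
Lemma even_complete (F C : G -> nat) (J : {set 'I_m}) g :
  (forall x y, F (x +v y) + C y <= F x + big) ->
  (forall x, exists2 D, good_table x D & forall y, D x y <= C y) ->
  par J =1 xpred0 -> F g <= F (g +v weight J) + #|J|.
Proof.
move=> clF hC; have [k] := ubnP #|J|; elim: k J g => // k IHk J g leJ pJ.
have [-> | [e eJ]] := set_0Vmem J; first by rewrite weight0 gadd0 leq_addr.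
case def_e : (ends I e) => [x y].
have exy : adj e x y by rewrite /adj def_e eqxx.
have seJ : [set e] \subset J by rewrite sub1set.
have cJ : #|J| = #|J :\: [set e]|.+1 by rewrite (cardsD1 e) eJ.
have wJ := weightD seJ; rewrite weight1 in wJ.
have [D [D0 clD _] leDC] := hC x.
(* The trail starts in the state that [e] reaches from the source (x, 0) of the search. *)
have [|P [sP pP leP]] := @trail D (J :\: [set e]) y x (elab I e) clD.
  by move=> v; rewrite parD // pJ par1 (adj_endpar _ exy) /= addbC.
have cP := cardsID P (J :\: [set e]); rewrite (setIidPr sP) in cP.
have wP := weightD sP.
set d := elab I e +v weight P.
have {IHk} := IHk _ (g +v d) _ pP; rewrite wP wJ.
have -> : g +v d +v (weight J +v elab I e +v weight P) = g +v weight J.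
  by rewrite -(gaddA (weight J)) -/d (gaddC (weight J)) gaddA gaddvK.
(* At the source the entry is [big], so after [e] it is at least [big] - 1. *)
have := clD e x y gzero exy; rewrite gadd0r D0.
have := leDC d; have := clF (g +v d) d; rewrite gaddvK.
move: leP cP cJ leJ; rewrite -/d.
have arith (a1 a2 a3 a4 a5 a6 a7 p j j1 j2 : nat) :
  a1 <= a2 + p -> p + j2 = j1 -> j = j1.+1 -> j < k.+1 -> a3 + a4 <= a5 + big ->
  a2 <= a4 -> big <= a1.+1 -> (j2 < k -> a5 <= a6 + j2) -> a3 <= a6 + j by lia.
exact: arith.
Qed.

End Joins.

(** * Reasoning about programs *)

Section RunLogic.

Variable w : nat.
Implicit Types (c : cmd) (e : expr) (s : memory) (Q : nat -> memory -> Prop).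

Definition runs c s Q := exists k s', exec w c s k s' /\ Q k s'.

(** A loop-free program takes time bounded by a constant that depends on its text alone, so only
    [While] needs an invariant and a budget. *)
Fixpoint loopfree c : bool :=
  match c with
  | Skip | Write _ _ _ => true
  | Seq c1 c2 | If _ c1 c2 => loopfree c1 && loopfree c2
  | While _ _ => false
  end.

(* The values on [While] are junk. *)
Fixpoint run c s : memory :=
  match c with
  | Skip | While _ _ => s
  | Write a i e => update s a (eval w s i) (eval w s e)
  | Seq c1 c2 => run c2 (run c1 s)
  | If e c1 c2 => if eval w s e == 0 then run c2 s else run c1 s
  end.

Fixpoint maxcost c : nat :=
  match c with
  | Skip | While _ _ => 1
  | Write _ i e => (cost i + cost e).+1
  | Seq c1 c2 => maxcost c1 + maxcost c2
  | If e c1 c2 => (cost e + maxn (maxcost c1) (maxcost c2)).+1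
  end.

Fixpoint writes c : seq nat :=
  match c with
  | Skip => [::]
  | Write a _ _ => [:: a]
  | Seq c1 c2 | If _ c1 c2 => writes c1 ++ writes c2
  | While _ c1 => writes c1
  end.

Lemma exec_run c s : loopfree c -> exists2 k, exec w c s k (run c s) & k <= maxcost c.
Proof.
elim: c s => //= [s _|a i e s _|c1 IH1 c2 IH2 s /andP[l1 l2]|e c1 IH1 c2 IH2 s /andP[l1 l2]].
- by exists 1 => //; constructor.
- by eexists; first by constructor.
- have [k1 x1 le1] := IH1 s l1; have [k2 x2 le2] := IH2 (run c1 s) l2.
  by exists (k1 + k2); [apply: ExecSeq x1 x2 | lia].
- case: eqP => [e0 | /eqP e_n0].
    have [k x le] := IH2 s l2; exists (cost e + k).+1; last by lia.
    exact: ExecIfFalse.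
  have [k x le] := IH1 s l1; exists (cost e + k).+1; last by lia.
  exact: ExecIfTrue.
Qed.

Lemma runs_loopfree c s Q :
  loopfree c -> (forall k, k <= maxcost c -> Q k (run c s)) -> runs c s Q.
Proof. by move=> /(@exec_run c s)[k x le] hQ; exists k, (run c s); split=> //; apply: hQ. Qed.

Lemma runs_conseq c s Q Q' : runs c s Q -> (forall k s', Q k s' -> Q' k s') -> runs c s Q'.
Proof. by move=> [k [s' [x q]]] h; exists k, s'; split=> //; apply: h. Qed.

Lemma runs_seq c1 c2 s Q :
  runs c1 s (fun k1 s1 => runs c2 s1 (fun k2 => Q (k1 + k2))) -> runs (Seq c1 c2) s Q.
Proof.
move=> [k1 [s1 [x1 [k2 [s2 [x2 q]]]]]]; exists (k1 + k2), s2; split=> //.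
exact: ExecSeq x1 x2.
Qed.

Lemma runs_if e c1 c2 s Q :
  (eval w s e != 0 -> runs c1 s (fun k => Q (cost e + k).+1)) ->
  (eval w s e = 0 -> runs c2 s (fun k => Q (cost e + k).+1)) ->
  runs (If e c1 c2) s Q.
Proof.
move=> h1 h2; case: (eqVneq (eval w s e) 0) => [e0 | e_n0].
  by have [k [s' [x q]]] := h2 e0; do 2!eexists; split; [apply: ExecIfFalse x | exact: q].
by have [k [s' [x q]]] := h1 e_n0; do 2!eexists; split; [apply: ExecIfTrue x | exact: q].
Qed.

(* In [Inv p], [p] is a time budget from which every iteration is paid. *)
Lemma runs_while e c (Inv : nat -> memory -> Prop) p s :
  (forall p s, Inv p s -> eval w s e != 0 ->
     runs c s (fun k s' => exists2 p', Inv p' s' & p' + k + (cost e).+1 <= p)) ->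
  Inv p s ->
  runs (While e c) s (fun k s' =>
    exists p', [/\ Inv p' s', eval w s' e = 0 & k + p' <= p + (cost e).+1]).
Proof.
move=> step; have [b] := ubnP p; elim: b p s => // b IHb p s le_p inv.
case: (eqVneq (eval w s e) 0) => [e0 | e_n0].
  by do 2!eexists; split; [apply: ExecWhileFalse | exists p; split=> //; lia].
have [k1 [s1 [x1 [p1 inv1 le1]]]] := step _ _ inv e_n0.
have [|k2 [s2 [x2 [p2 [inv2 e0 le2]]]]] := IHb p1 s1 _ inv1; first by lia.
by do 2!eexists; split; [apply: ExecWhileTrue x1 x2 | exists p2; split=> //; lia].
Qed.

Lemma exec_frame c s k s' a : exec w c s k s' -> a \notin writes c -> s' a =1 s a.
Proof.
elim=> {c s k s'} //=.
- by move=> b i e s; rewrite inE /update => /negbTE ->.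
- by move=> c1 c2 s1 s2 s3 k1 k2 _ IH1 _ IH2; rewrite mem_cat negb_or
    => /andP[/IH1 h1 /IH2 h2] i; rewrite h2 h1.
- by move=> e c1 c2 s s' k _ _ IH; rewrite mem_cat negb_or => /andP[/IH].
- by move=> e c1 c2 s s' k _ _ IH; rewrite mem_cat negb_or => /andP[_ /IH].
- by move=> e c s1 s2 s3 k1 k2 _ _ IH1 _ IH2 na i; rewrite IH2 // IH1.
Qed.

Lemma run_frame c s a : loopfree c -> a \notin writes c -> run c s a =1 s a.
Proof. by move=> /(@exec_run c s)[k x _]; apply: exec_frame x. Qed.

Lemma runs_frame c s Q :
  runs c s Q ->
  runs c s (fun k s' => Q k s' /\ forall a, a \notin writes c -> s' a =1 s a).
Proof.
move=> [k [s' [x q]]]; exists k, s'; split=> //; split=> // a na i.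
exact: exec_frame x na _.
Qed.

End RunLogic.

(** * Derived constructs of the language *)

Definition Var (a : nat) : expr := Read a (Const 0).
Definition Assign (a : nat) (e : expr) : cmd := Write a (Const 0) e.

(** The machine cannot multiply; the only factor that occurs is the constant [nlab t]. *)
Fixpoint Scale (k : nat) (e : expr) : expr :=
  if k is k'.+1 then Add e (Scale k' e) else Const 0.

Lemma eval_Scale w s k e : eval w s (Scale k e) = (k * eval w s e) %% 2 ^ w.
Proof. by elim: k => [|k IHk] //=; rewrite IHk modnDmr mulSn. Qed.

Fixpoint Fill (a : nat) (f : nat -> expr) (k : nat) : cmd :=
  if k is k'.+1 then Seq (Fill a f k') (Write a (Const k') (f k')) else Skip.

Lemma loopfree_Fill a f k : loopfree (Fill a f k).
Proof. by elim: k => //= k ->. Qed.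

Lemma writes_Fill a f k b : b != a -> b \notin writes (Fill a f k).
Proof. by move=> neq; elim: k => //= k IHk; rewrite mem_cat negb_or IHk inE. Qed.

(** When cell [j] is written, only the cells of [a] below [j] have changed. So [f j] may read other
    arrays and the cells of [a] from [j] on, which allows updating an entry in place. *)
Lemma run_Fill w s a f k :
  k <= 2 ^ w ->
  (forall s' j, j < k -> (forall b i, (b != a) || (j <= i) -> s' b i = s b i) ->
     eval w s' (f j) = eval w s (f j)) ->
  forall b i, run w (Fill a f k) s b i =
    if (b == a) && (i < k) then eval w s (f i) else s b i.
Proof.
elim: k => [|k IHk] /=; first by move=> *; rewrite andbF.
move=> le_k hloc b i; have {}IHk := IHk (ltnW le_k) _.
rewrite /update modn_small // IHk; last by move=> s' j lt_j; apply: hloc; exact: leqW.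
rewrite ltnS; have [-> | neq] := eqVneq b a => //=.
have [-> | neq_i] := eqVneq i k.
  rewrite leqnn; apply: (hloc) => // b' j h; rewrite IHk; last first.
    by move=> s' j' lt_j; apply: hloc; exact: leqW.
  by case: ifP => // /andP[/eqP eb lt_j]; move: h; rewrite eb eqxx /= leqNgt lt_j.
by rewrite ltn_neqAle neq_i.
Qed.

(** * Breadth-first search in the cover *)

Section Arcs.

Variables (T : eqType) (asrc : nat -> T).

(* The linked list of the arcs leaving [u], most recent first: its head after
   [k] insertions is [last_arc u k], and [a] is followed by
   [last_arc (asrc a) a.-1]. *)
Fixpoint last_arc (u : T) (k : nat) : nat :=
  if k is k'.+1 then if asrc k == u then k else last_arc u k' else 0.

Definition outdeg (u : T) (k : nat) : nat := \sum_(i < k) (asrc i.+1 == u).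

Lemma last_arc_le u k : last_arc u k <= k.
Proof. by elim: k => //= k IHk; case: ifP => // _; exact: leqW. Qed.

Lemma last_arc_src u k : 0 < last_arc u k -> asrc (last_arc u k) = u.
Proof. by elim: k => //= k IHk; case: eqP. Qed.

Lemma last_arc_last u k a : last_arc u k < a <= k -> asrc a != u.
Proof.
elim: k => /= [|k IHk]; first by case: a.
case: ifP => [_|neq]; first by rewrite ltnNge andNb.
move=> /andP[lt_a]; rewrite leq_eqVlt ltnS => /orP[/eqP -> | le_a]; first by rewrite neq.
by apply: IHk; rewrite lt_a.
Qed.

(** Following one link of the list of [u] leaves exactly one arc fewer to scan; this pays for the
    iteration. *)
Lemma outdeg_last u k :
  0 < last_arc u k -> outdeg u k = (outdeg u (last_arc u k).-1).+1.
Proof.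
rewrite /outdeg; elim: k => //= k IHk; rewrite big_ord_recr /=.
by case: eqP => _ /=; rewrite ?addn1 // => /IHk ->; rewrite addn0.
Qed.

End Arcs.

(** * The invariant of the search and its preservation *)

Section BFS.

Variables (t n m : nat) (I : instance t n m).
Notation G := (lab t).
Notation X := ('I_n * G)%type.
Variables (asrc ato : nat -> 'I_n) (alab : nat -> G) (M big : nat).
Hypothesis arcs_sound : forall a, 0 < a <= M ->
  exists2 e, adj I e (asrc a) (ato a) & elab I e = alab a.
Hypothesis arcs_complete : forall e x y, adj I e x y ->
  exists a, [/\ 0 < a <= M, asrc a = x, ato a = y & alab a = elab I e].
Hypothesis big_large : #|{: X}| < big.
Variable s0 : 'I_n.

Notation x0 := ((s0, gzero) : X).
Definition follow (x : X) (a : nat) : X := (ato a, x.2 +v alab a).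

(* [q] lists the states reached so far, of which the first [h] are scanned, as
   are the arcs after the [k]-th at the next one. *)
Record bfs_inv (q : seq X) (h k : nat) (D : X -> nat) : Prop := BfsInv {
  bfs_uniq : uniq q;
  bfs_h : h <= size q;
  bfs_src : D x0 = big;
  bfs_mem : forall x, (0 < D x) = (x \in q);
  bfs_sound : forall x, 0 < D x ->
    realizes I big (fun v => (v == s0) (+) (v == x.1)) x.2 (D x);
  bfs_depth : forall i, i < size q -> big <= D (nth x0 q i) + i;
  bfs_mono : forall i j, i <= j < size q -> D (nth x0 q j) <= D (nth x0 q i);
  bfs_near : forall j, h < size q -> j < size q ->
    D (nth x0 q h) <= (D (nth x0 q j)).+1;
  bfs_done : forall i a, i < size q -> 0 < a <= M -> asrc a = (nth x0 q i).1 ->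
    (i < h) || (i == h) && (k < a) ->
    D (nth x0 q i) <= (D (follow (nth x0 q i) a)).+1
}.

Lemma bfs_init : bfs_inv [:: x0] 0 M (fun x => if x == x0 then big else 0).
Proof.
have big_gt0 : 0 < big by exact: leq_ltn_trans (leq0n _) big_large.
split=> //=.
- by rewrite eqxx.
- by move=> x; rewrite inE; case: eqP.
- move=> x; case: eqP => // -> _ /=; exact: realizes_refl.
- by case=> // _; rewrite eqxx addn0.
- by move=> i [|j] /andP[] //; rewrite leqn0 => /eqP ->.
- by case=> // _ _; rewrite eqxx.
- move=> [|i] a // _ /andP[_ le_a] _ /=; rewrite ltnNge le_a; by [].
Qed.

Lemma bfs_size q h k D : bfs_inv q h k D -> size q <= #|{: X}|.
Proof. by move=> [uq _ _ _ _ _ _ _ _]; rewrite -(card_uniqP uq) max_card. Qed.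

Lemma bfs_skip q h k k' D :
  bfs_inv q h k D -> (forall a, k' < a <= k -> asrc a != (nth x0 q h).1) ->
  bfs_inv q h k' D.
Proof.
move=> [] uq hq Ds memq snd dep mon nea don skip; split=> // i a lt_i a_le src_a.
move=> /orP[lt_ih | /andP[/eqP eq_ih lt_a]]; first by apply: don; rewrite ?lt_ih.
have [le_a | lt_ka] := leqP a k; last by apply: don; rewrite // eq_ih eqxx lt_ka orbT.
by move: (skip a); rewrite lt_a le_a src_a eq_ih eqxx => /(_ isT).
Qed.

(** An arc into a reached state obeys the closure inequality because no reached entry lies more than
    1 below that of the state being scanned ([bfs_near]): the queue spans at most two consecutive
    levels from there on. *)
Lemma bfs_old q h k D :
  bfs_inv q h k D -> 0 < k -> h < size q ->
  0 < D (follow (nth x0 q h) k) -> bfs_inv q h k.-1 D.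
Proof.
move=> [] uq hq Ds memq snd dep mon nea don k_gt0 lt_h old; split=> //.
move=> i a lt_i a_le src_a.
move=> /orP[lt_ih | /andP[/eqP eq_ih lt_a]]; first by apply: don; rewrite ?lt_ih.
have [lt_ka | le_a] := ltnP k a; first by apply: don; rewrite // eq_ih eqxx lt_ka orbT.
have eq_a : a = k by lia.
have y_q : follow (nth x0 q h) k \in q by rewrite -memq.
by have := nea _ lt_h; rewrite eq_ih eq_a -(nth_index x0 y_q); apply; rewrite index_mem.
Qed.

Definition put (D : X -> nat) (y : X) (z : nat) : X -> nat :=
  fun x => if x == y then z else D x.

Lemma bfs_new q h k D :
  bfs_inv q h k D -> 0 < k <= M -> h < size q -> asrc k = (nth x0 q h).1 ->
  let y := follow (nth x0 q h) k in D y = 0 ->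
  bfs_inv (rcons q y) h k.-1 (put D y (D (nth x0 q h)).-1).
Proof.
move=> inv k_le lt_h src_k y Dy0; have le_size := bfs_size inv.
case: inv => uq hq Ds memq snd dep mon nea don.
have yNq : y \notin q by rewrite -memq Dy0.
have dep_h := dep _ lt_h.
(* The entry is at least [big] - h, and h is less than the number of states. Hence the decreased
   entry of the new state is still positive and cannot be taken for unreachable. *)
have D_gt1 : 1 < D (nth x0 q h) by move: big_large; lia.
have oldE i : i < size q -> put D y (D (nth x0 q h)).-1 (nth x0 (rcons q y) i) = D (nth x0 q i).
  move=> lt_i; rewrite nth_rcons lt_i /put ifN //.
  by apply: contraNneq yNq => <-; apply: mem_nth.
have newE : put D y (D (nth x0 q h)).-1 (nth x0 (rcons q y) (size q)) = (D (nth x0 q h)).-1.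
  by rewrite nth_rcons ltnn eqxx /put eqxx.
(* The new value replaces a 0, so the inequalities established for arcs into [y] persist. *)
have geD x : D x <= put D y (D (nth x0 q h)).-1 x.
  by rewrite /put; case: eqP => // ->; rewrite Dy0.
have sizeE i : i < size (rcons q y) -> i < size q \/ i = size q.
  by rewrite size_rcons ltnS leq_eqVlt => /orP[/eqP | ]; [right | left].
split.
- by rewrite rcons_uniq yNq.
- by rewrite size_rcons ltnW.
- rewrite /put ifN //; apply: contraNneq yNq => <-; rewrite -memq Ds.
  exact: leq_ltn_trans (leq0n _) big_large.
- move=> x; rewrite mem_rcons inE /put; case: eqP => _ /=; last exact: memq.
  by rewrite -ltnS prednK // ltnW.
- move=> x; rewrite /put; case: eqP => [-> _ | _]; last exact: snd.
  have [e exy lab_e] := arcs_sound k_le; rewrite /y /= -lab_e.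
  have Dh_gt0 : 0 < D (nth x0 q h) by lia.
  by apply: (realizes_step exy) => //; rewrite src_k; apply: snd.
- move=> i /sizeE[lt_i | ->]; first by rewrite oldE //; exact: dep.
  rewrite newE; lia.
- move=> i j /andP[le_ij /sizeE[lt_j | eq_j]].
    by rewrite !oldE //; [apply: mon; rewrite le_ij | exact: leq_ltn_trans lt_j].
  move: le_ij; rewrite eq_j newE leq_eqVlt => /orP[/eqP -> | lt_i]; first by rewrite newE.
  (* [bfs_near] before the insertion keeps the queue sorted after it. *)
  by rewrite oldE //; have := nea i lt_h lt_i; lia.
- move=> j _ /sizeE[lt_j | ->]; first by rewrite !oldE //; exact: nea.
  by rewrite (oldE h) // newE; lia.
- move=> i a /sizeE[lt_i | ->] a_le; last first.
    by move=> _; rewrite [size q < h]ltnNge hq /= eqn_leq [size q <= h]leqNgt lt_h.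
  rewrite oldE // nth_rcons lt_i => src_a hd.
  have old_done : (i < h) || (i == h) && (k < a) ->
      D (nth x0 q i) <= (put D y (D (nth x0 q h)).-1 (follow (nth x0 q i) a)).+1.
    by move=> hd'; apply: leq_trans (don i a lt_i a_le src_a hd') _; rewrite ltnS geD.
  move: hd old_done; case: ltngtP => //= [_ _ -> // | eq_ih lt_a].
  have [lt_ka -> // | le_ak _] := ltnP k a.
  have eq_a : a = k by lia.
  by rewrite eq_ih eq_a /put eqxx; lia.
Qed.

Lemma bfs_advance q h D : bfs_inv q h 0 D -> h < size q -> bfs_inv q h.+1 M D.
Proof.
move=> [] uq hq Ds memq snd dep mon nea don lt_h; split=> //.
- move=> j lt_h1 lt_j; apply: leq_trans (nea _ lt_h lt_j).
  by apply: mon; rewrite leqnSn.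
- move=> i a lt_i a_le src_a hd; apply: don => //; move: hd a_le; lia.
Qed.

(** Once the queue is exhausted, [bfs_done] covers all arcs out of reached states; out of an
    unreached state the inequality is trivial, its entry being 0. *)
Lemma bfs_good q k D :
  bfs_inv q (size q) k D -> good_table I big s0 (fun v g => D (v, g)).
Proof.
move=> [] uq hq Ds memq snd dep mon nea don; split=> //.
- move=> e x y g /arcs_complete[a [a_le src_a to_a lab_a]].
  case: (posnP (D (x, g))) => [-> // | ]; rewrite memq => xq.
  have lt_i : index (x, g) q < size q by rewrite index_mem.
  have := don _ a lt_i a_le; rewrite nth_index // lt_i => /(_ src_a isT).
  by rewrite /follow to_a lab_a.
- by move=> y g; apply: snd.
Qed.

(** Counts the arcs of the cover already followed. Each discovery is charged to one of them, so the
    queue exceeds this number by at most 1. *)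
Definition scanned (q : seq X) (h : nat) := \sum_(x <- take h q) outdeg asrc x.1 M.

Lemma scannedS q h : h < size q ->
  scanned q h.+1 = scanned q h + outdeg asrc (nth x0 q h).1 M.
Proof. by move=> lt_h; rewrite /scanned (take_nth x0) // big_rcons /= addnC. Qed.

Lemma scanned_le q h : uniq q -> scanned q h <= #|{: G}| * M.
Proof.
move=> uq; apply: (@leq_trans (\sum_(x : X) outdeg asrc x.1 M)).
  rewrite /scanned big_uniq ?take_uniq //= [X in _ <= X](bigID [in take h q]) /=.
  exact: leq_addr.
rewrite -(pair_big xpredT xpredT (fun v (g : G) => outdeg asrc v M)) /=.
rewrite exchange_big /= sum_nat_const leq_mul // /outdeg exchange_big /=.
rewrite -[X in _ <= X]card_ord -sum1_card; apply: leq_sum => a _.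
by rewrite (bigD1 (asrc a.+1)) //= eqxx big1 // => v /negbTE; rewrite eq_sym => ->.
Qed.

End BFS.

(** * The search program *)

(* [aTab] is the addition table of the labels, which are represented by their
   ranks; [aHead], [aNxt], [aTo], [aLab] are the lists of arcs; [aQU], [aQB] hold the
   vertices and labels of the queued states, from [aQH] to [aQT] excluded; [aD] is
   the table of the current search, and [aC] that of the closed walks. *)
Local Notation aIn := 0 (only parsing).
Local Notation aOut := 1 (only parsing).
Local Notation aTab := 2 (only parsing).
Local Notation aG := 3 (only parsing).
Local Notation aPos := 4 (only parsing).
Local Notation aTgt := 5 (only parsing).
Local Notation aE := 6 (only parsing).
Local Notation aA := 7 (only parsing).
Local Notation aHead := 8 (only parsing).
Local Notation aNxt := 9 (only parsing).
Local Notation aTo := 10 (only parsing).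
Local Notation aLab := 11 (only parsing).
Local Notation aBig := 12 (only parsing).
Local Notation aV := 13 (only parsing).
Local Notation aD := 14 (only parsing).
Local Notation aQU := 15 (only parsing).
Local Notation aQB := 16 (only parsing).
Local Notation aQH := 17 (only parsing).
Local Notation aQT := 18 (only parsing).
Local Notation aU := 19 (only parsing).
Local Notation aB := 20 (only parsing).
Local Notation aZ := 21 (only parsing).
Local Notation aY := 22 (only parsing).
Local Notation aW := 23 (only parsing).
Local Notation aC := 24 (only parsing).
(* The tables of the successive stages of the final dynamic program occupy the
   arrays from [aF] on. *)
Local Notation aF := 25 (only parsing).

Local Notation "c1 ;; c2" := (Seq c1 c2) (at level 61, right associativity).

Definition nlab (t : nat) : nat := #|lab t|.

Section Program.

Variable t : nat.
Notation K := (nlab t).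

Definition rk (x : lab t) : nat := enum_rank x.
Definition unrk (i : nat) : lab t := nth gzero (enum (lab t)) i.

Lemma rk_lt x : rk x < K.
Proof. exact: ltn_ord. Qed.

Lemma rkK x : unrk (rk x) = x.
Proof. exact: nth_enum_rank. Qed.

Lemma unrkK i : i < K -> rk (unrk i) = i.
Proof.
move=> lt_i; rewrite -[i]/(val (Ordinal lt_i)) /rk /unrk.
by rewrite -(enum_val_nth gzero) enum_valK.
Qed.

Lemma rk_inj : injective rk.
Proof. by move=> x y eq_xy; rewrite -[x]rkK eq_xy rkK. Qed.

Definition Pair (u b : expr) : expr := Add (Scale K u) b.
Definition Incr (a : nat) : cmd := Assign a (Add (Var a) (Const 1)).
Definition Sum (b g : expr) : expr := Read aTab (Pair b g).

(** To the machine a label is a mere rank; addition is hard-wired as a table of [K * K] constants, a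
    number depending on [t] alone. *)
Definition init_sums : cmd :=
  Fill aTab (fun i => Const (rk (unrk (i %/ K) +v unrk (i %% K)))) (K * K).

Definition bfs_start : cmd :=
  Write aQU (Const 0) (Var aV) ;;
  Write aQB (Const 0) (Const (rk gzero)) ;;
  Write aD (Pair (Var aV) (Const (rk gzero))) (Var aBig) ;;
  Assign aQH (Const 0) ;;
  Assign aQT (Const 1).

Definition scan_start : cmd :=
  Assign aU (Read aQU (Var aQH)) ;;
  Assign aB (Read aQB (Var aQH)) ;;
  Assign aZ (Read aD (Pair (Var aU) (Var aB))) ;;
  Assign aA (Read aHead (Var aU)).

Definition scan_arc : cmd :=
  Assign aY (Read aTo (Var aA)) ;;
  Assign aW (Sum (Var aB) (Read aLab (Var aA))) ;;
  If (Read aD (Pair (Var aY) (Var aW))) Skip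
    (Write aD (Pair (Var aY) (Var aW)) (Defs.Sub (Var aZ) (Const 1)) ;;
     Write aQU (Var aQT) (Var aY) ;;
     Write aQB (Var aQT) (Var aW) ;;
     Incr aQT) ;;
  Assign aA (Read aNxt (Var aA)).

Definition bfs : cmd :=
  bfs_start ;;
  While (Defs.Sub (Var aQT) (Var aQH)) (scan_start ;; While (Var aA) scan_arc ;; Incr aQH).

Definition erase_next : cmd :=
  Write aD (Pair (Read aQU (Var aQH)) (Read aQB (Var aQH))) (Const 0) ;; Incr aQH.

Definition erase : cmd :=
  Assign aQH (Const 0) ;; While (Defs.Sub (Var aQT) (Var aQH)) erase_next.

End Program.

Definition evalE := (eval_Scale, modnDml, mod0n).

(** * The program simulates the abstract search *)

Section Simulation.

Variables (t n m : nat) (I : instance t n m) (w : nat).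
Notation K := (nlab t).
Notation G := (lab t).
Notation X := ('I_n * G)%type.
Variables (asrc ato : nat -> 'I_n) (alab : nat -> G) (M : nat).
Hypothesis arcs_sound : forall a, 0 < a <= M ->
  exists2 e, adj I e (asrc a) (ato a) & elab I e = alab a.
Hypothesis arcs_complete : forall e x y, adj I e x y ->
  exists a, [/\ 0 < a <= M, asrc a = x, ato a = y & alab a = elab I e].

(** Exceeds the number [K * n] of states, so that reached entries stay positive, and also [m], so
    that every edge set has a size below it. *)
Definition max_value : nat := K * n + m + 1.
Notation big := max_value.
(** Makes room, without wrap-around, for indices into the addition table ([K * K]), sums of two
    table entries ([2 * big]) and positions in the input. *)
Hypothesis fits : K * K + 2 * big + m * (t + 2) + t + 10 < 2 ^ w.

Lemma const1 : 1 %% 2 ^ w = 1.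
Proof. by rewrite modn_small //; move: fits; lia. Qed.

Lemma pair_lt (u : 'I_n) (x : G) : K * u + rk x < K * n.
Proof.
apply: (@leq_trans (K * u.+1)); first by rewrite mulnS addnC ltn_add2r rk_lt.
by rewrite leq_mul2l ltn_ord orbT.
Qed.

Lemma pair_mod (u : 'I_n) (x : G) : (K * u + rk x) %% 2 ^ w = K * u + rk x.
Proof. by rewrite modn_small //; have := pair_lt u x; move: fits; rewrite /max_value; lia. Qed.

Lemma pair_inj (x y : X) : (K * x.1 + rk x.2 == K * y.1 + rk y.2) = (x == y).
Proof.
case: x y => [u x] [v y] /=; have K_gt0 : 0 < K by exact: leq_ltn_trans (rk_lt gzero).
apply/eqP/eqP => [eqp | [-> ->] //].
have /ord_inj -> : u = v :> nat.
  have := congr1 (divn^~ K) eqp; rewrite ![K * _]mulnC !divnMDl //.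
  by rewrite !divn_small ?rk_lt // !addn0.
have /rk_inj -> // : rk x = rk y.
have := congr1 (modn^~ K) eqp; rewrite ![K * _]mulnC !modnMDl.
by rewrite !modn_small ?rk_lt.
Qed.

Lemma rk_mod (x : G) : rk x %% 2 ^ w = rk x.
Proof.
rewrite modn_small //; have := rk_lt x.
by have := leq_pmulr K (leq_ltn_trans (leq0n _) (rk_lt x)); move: fits; lia.
Qed.

Lemma sum_mod (x y : G) : (K * rk x + rk y) %% 2 ^ w = K * rk x + rk y.
Proof.
rewrite modn_small //; apply: (@leq_trans (K * K)); last by move: fits; lia.
apply: (@leq_trans (K * (rk x).+1)); first by rewrite mulnS addnC ltn_add2r rk_lt.
by rewrite leq_mul2l rk_lt orbT.
Qed.

Definition rep_sums (s : memory) : Prop :=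
  forall x y : G, s aTab (K * rk x + rk y) = rk (x +v y).

Definition rep_arcs (s : memory) (k : nat) : Prop :=
  (forall u : 'I_n, s aHead u = last_arc asrc u k) /\
  (forall a, 0 < a <= k ->
    [/\ s aNxt a = last_arc asrc (asrc a) a.-1, s aTo a = ato a & s aLab a = rk (alab a)]).

Definition rep_table (s : memory) (D : X -> nat) : Prop :=
  forall (v : 'I_n) (g : G), s aD (K * v + rk g) = D (v, g).

Variable s0 : 'I_n.
Notation x0 := ((s0, gzero) : X).

Definition rep_queue (s : memory) (q : seq X) : Prop :=
  s aQT 0 = size q /\
  forall i, i < size q ->
    s aQU i = (nth x0 q i).1 /\ s aQB i = rk (nth x0 q i).2.

Lemma run_init_sums s : rep_sums (run w (init_sums t) s).
Proof.
move=> x y; have K_gt0 : 0 < K by exact: leq_ltn_trans (rk_lt gzero).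
rewrite run_Fill; [|by move: fits; lia|by []].
have -> : K * rk x + rk y < K * K.
  apply: (@leq_trans (K * (rk x).+1)); first by rewrite mulnS addnC ltn_add2r rk_lt.
  by rewrite leq_mul2l rk_lt orbT.
rewrite /= rk_mod mulnC divnMDl // modnMDl divn_small ?rk_lt // addn0 modn_small ?rk_lt //.
by rewrite !rkK.
Qed.

Lemma run_bfs_start s :
  s aBig 0 = big -> s aV 0 = s0 -> rep_table s (fun=> 0) ->
  let s' := run w (bfs_start t) s in
  [/\ rep_table s' (fun x => if x == x0 then big else 0), rep_queue s' [:: x0] & s' aQH 0 = 0].
Proof.
move=> sbig sV tab; rewrite /= !evalE /= !evalE const1 /update /= sV sbig rk_mod pair_mod.
split=> //.
- by move=> v g /=; rewrite (pair_inj (v, g) x0); case: ifP => // _; exact: tab.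
- by split=> //= -[|i] //= _; rewrite sV.
Qed.

Lemma run_scan_start s q D h :
  rep_table s D -> rep_queue s q -> s aQH 0 = h -> h < size q ->
  let x := nth x0 q h in let s' := run w (scan_start t) s in
  [/\ s' aU 0 = x.1, s' aB 0 = rk x.2, s' aZ 0 = D x & s' aA 0 = s aHead x.1].
Proof.
move=> tab [sQT sq] sQH lt_h; have [sU sB] := sq h lt_h.
rewrite /= !evalE /= !evalE /update /= sQH sU sB.
by rewrite pair_mod tab -surjective_pairing.
Qed.

Record rep_graph (s : memory) : Prop := RepGraph {
  graph_sums : rep_sums s;
  graph_arcs : rep_arcs s M;
  graph_big : s aBig 0 = big
}.

Lemma rep_graph_frame (s s' : memory) :
  (forall a, a \in [:: aTab; aHead; aNxt; aTo; aLab; aBig] -> s' a =1 s a) ->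
  rep_graph s -> rep_graph s'.
Proof.
move=> eqs [sums [hd arcs] sbig]; split=> [x y | | ].
- by rewrite eqs.
- by split=> [u | a a_le]; rewrite !eqs //; exact: arcs.
- by rewrite eqs.
Qed.

Hypothesis big_large : #|{: X}| < big.

Definition scanning (s : memory) (q : seq X) (h k : nat) (D : X -> nat) : Prop :=
  let x := nth x0 q h in
  [/\ rep_graph s, rep_table s D, rep_queue s q, s aQH 0 = h & h < size q] /\
  [/\ s aB 0 = rk x.2, s aZ 0 = D x, s aA 0 = last_arc asrc x.1 k, k <= M &
      bfs_inv I asrc ato alab M big s0 q h k D].

Lemma card_X : #|{: X}| = n * K.
Proof. by rewrite card_prod card_ord. Qed.

(** First [bfs_skip] lowers the counter to the head of the remaining list; that arc then discovers a
    state ([bfs_new]) or leads to a known one ([bfs_old]). *)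
Lemma run_scan_arc s q h k D :
  scanning s q h k D -> s aA 0 != 0 ->
  exists q' D', [/\ scanning (run w (scan_arc t) s) q' h (last_arc asrc (nth x0 q h).1 k).-1 D',
    take h q' = take h q, nth x0 q' h = nth x0 q h & size q' <= (size q).+1].
Proof.
set x := nth x0 q h => -[[gr tab [sQT sq] sQH lt_h] [sB sZ sA le_k inv]] A_n0.
have a_gt0 : 0 < last_arc asrc x.1 k by rewrite -sA lt0n.
set a := last_arc asrc x.1 k in a_gt0 sA *.
have a_le : 0 < a <= M by rewrite a_gt0 (leq_trans (last_arc_le _ _ _)).
have src_a : asrc a = x.1 by apply: last_arc_src.
have inv_a : bfs_inv I asrc ato alab M big s0 q h a D.
  by apply: bfs_skip inv _ => b; apply: last_arc_last.
have [_ /(_ a a_le)[nxt_a to_a lab_a]] := graph_arcs gr.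
have size_q := bfs_size inv; rewrite card_X in size_q.
have gr' : rep_graph (run w (scan_arc t) s).
  by apply: rep_graph_frame gr => b bs; apply: run_frame => //; move: b bs; apply/allP.
have [y y_def] : exists y, y = follow ato alab x a by eexists.
have evY : (K * s aTo (s aA 0) + s aTab ((K * s aB 0 + s aLab (s aA 0)) %% 2 ^ w)) %% 2 ^ w
   = K * y.1 + rk y.2.
  by rewrite sA to_a lab_a sB sum_mod (graph_sums gr) pair_mod y_def.
have sY : s aTab ((K * s aB 0 + s aLab (s aA 0)) %% 2 ^ w) = rk y.2.
  by rewrite sA lab_a sB sum_mod (graph_sums gr) y_def.
have [D_y | D_y] := posnP (D y).
- have ev b i : run w (scan_arc t) s b i =
    if (b == aA) && (i == 0) then s aNxt (s aA 0)
    else if (b == aQT) && (i == 0) then (s aQT 0).+1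
    else if (b == aQB) && (i == s aQT 0) then rk y.2
    else if (b == aQU) && (i == s aQT 0) then y.1 : nat
    else if (b == aD) && (i == K * y.1 + rk y.2) then (s aZ 0).-1
    else if (b == aW) && (i == 0) then rk y.2
    else if (b == aY) && (i == 0) then y.1 : nat
    else s b i.
    rewrite /= !evalE /= !evalE /update /= ?evalE evY tab -surjective_pairing D_y /=.
    rewrite sY sA to_a const1 subn1 addn1 modn_small ?y_def // sQT.
    by move: fits; rewrite /max_value; lia.
  have nthE : nth x0 (rcons q y) h = x by rewrite nth_rcons lt_h.
  (* The entry of [x] was copied to [aZ] before the loop over the arcs; the copy stays valid because
     only the entry of [y] changes. *)
  have yNx : x != y.
    by apply/eqP => eq_xy; have := mem_nth x0 lt_h; rewrite -(bfs_mem inv) -/x eq_xy D_y.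
  exists (rcons q y), (put D y (D x).-1); split=> //; last by rewrite size_rcons.
    split; split=> //.
    - move=> v g; rewrite ev /= (pair_inj (v, g) y) /put sZ.
      by case: eqP => // _; exact: tab.
    - split=> [|i]; first by rewrite ev /= sQT size_rcons.
      rewrite size_rcons ltnS nth_rcons !ev /= sQT.
      by case: ltngtP => //= lt_i _; exact: sq.
    - by rewrite ev.
    - by rewrite size_rcons ltnW.
    - by rewrite ev nthE.
    - by rewrite ev /= nthE /put (negbTE yNx).
    - by rewrite ev /= sA nxt_a src_a nthE.
    - by apply: leq_trans le_k; apply: leq_trans (leq_pred _) (last_arc_le _ _ _).
    - by move: D_y; rewrite y_def; exact: bfs_new.
  by rewrite -cats1 takel_cat // ltnW.
have ev b i : run w (scan_arc t) s b i =
    if (b == aA) && (i == 0) then s aNxt (s aA 0)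
    else if (b == aW) && (i == 0) then rk y.2
    else if (b == aY) && (i == 0) then y.1 : nat
    else s b i.
  rewrite /= !evalE /= !evalE /update /= ?evalE evY tab -surjective_pairing (gtn_eqF D_y) /=.
  by rewrite sY sA to_a y_def.
exists q, D; split=> //; split; split=> //.
- by move=> v g; rewrite ev /= tab.
- by split=> [|i lt_i]; rewrite !ev //=; exact: sq.
- by rewrite ev.
- by rewrite ev.
- by rewrite ev.
- by rewrite ev /= sA nxt_a src_a.
- by apply: leq_trans le_k; apply: leq_trans (leq_pred _) (last_arc_le _ _ _).
- by apply: (bfs_old big_large inv_a a_gt0 lt_h); rewrite -y_def.
Qed.

(** The 3 here and the 6 in [state_cost] pay for the tests of the inner and the outer loop. *)
Definition arc_cost : nat := maxcost (scan_arc t) + 3.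

Lemma runs_scan s q h D :
  scanning s q h M D ->
  let x := nth x0 q h in let d := outdeg asrc x.1 M in
  runs w (While (Var aA) (scan_arc t)) s (fun c s' => c <= arc_cost * d + arc_cost /\
    exists q' D', [/\ scanning s' q' h 0 D', take h q' = take h q, nth x0 q' h = x &
      size q' <= size q + d]).
Proof.
move=> sc x d.
(* Each arc still to be scanned carries a budget of [arc_cost] and can add at most one state to the
   queue. *)
pose Inv p s' := exists q' k D',
  [/\ scanning s' q' h k D', take h q' = take h q, nth x0 q' h = x,
      size q' + outdeg asrc x.1 k <= size q + d & p = arc_cost * outdeg asrc x.1 k].
have start : Inv (arc_cost * d) s by exists q, M, D.
apply: (runs_conseq (runs_while _ start)); last first.
  move=> c s' [p [[q' [k [D' [[sc1 sc2] tk nt le_q eq_p]]]] /= e0 le_c]].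
  split; first by move: le_c; rewrite /arc_cost; lia.
  exists q', D'; split=> //; last exact: leq_trans (leq_addr _ _) le_q.
  rewrite mod0n in e0; case: sc2 => sB sZ sA le_k inv; split=> //; split=> //.
  by apply: bfs_skip inv _ => b; rewrite -{1}e0 sA; exact: last_arc_last.
move=> p s' [q' [k [D' [sc' tk nt le_q ->]]]] /=; rewrite mod0n => A_n0.
apply: runs_loopfree => // c le_c.
have [q'' [D'' [sc'' tk'' nt'' le_q'']]] := run_scan_arc sc' A_n0.
have a_gt0 : 0 < last_arc asrc x.1 k.
  by case: sc' => _ [_ _ sA _ _]; rewrite -nt -sA lt0n.
exists (arc_cost * outdeg asrc x.1 (last_arc asrc x.1 k).-1).
  rewrite nt in sc''; exists q'', (last_arc asrc x.1 k).-1, D''; split=> //; rewrite ?tk'' ?nt'' //.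
  by move: le_q; rewrite (outdeg_last a_gt0); lia.
by rewrite (outdeg_last a_gt0) mulnS /arc_cost; lia.
Qed.

Definition state_cost : nat := maxcost (scan_start t) + arc_cost + maxcost (Incr aQH) + 6.

Definition searching (s : memory) (q : seq X) (h : nat) (D : X -> nat) : Prop :=
  [/\ rep_graph s, rep_table s D, rep_queue s q, s aQH 0 = h &
      bfs_inv I asrc ato alab M big s0 q h M D].

Lemma size_fits q k D h : bfs_inv I asrc ato alab M big s0 q h k D -> h < size q -> h + 1 < 2 ^ w.
Proof. by move=> /bfs_size; rewrite card_X; move: fits; rewrite /max_value mulnC; lia. Qed.

Lemma runs_search_step s q h D :
  searching s q h D -> h < size q -> let d := outdeg asrc (nth x0 q h).1 M in
  runs w (scan_start t ;; While (Var aA) (scan_arc t) ;; Incr aQH) s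
    (fun c s' => c + 6 <= state_cost + arc_cost * d /\
       exists q' D', [/\ searching s' q' h.+1 D', scanned asrc M q' h.+1 = scanned asrc M q h + d &
         size q' <= size q + d]).
Proof.
move=> [gr tab qu sQH inv] lt_h d.
apply: runs_seq; apply: runs_loopfree => // c1 le_c1.
have [sU sB sZ sA] := run_scan_start tab qu sQH lt_h.
have frame a : a \notin [:: aU; aB; aZ; aA] -> run w (scan_start t) s a =1 s a.
  by move=> na; apply: run_frame.
move: (run _ _ _) sU sB sZ sA frame => s1 sU sB sZ sA frame.
have gr1 : rep_graph s1.
  by apply: rep_graph_frame gr => a a_in; apply: frame; move: a a_in; apply/allP.
have sc : scanning s1 q h M D.
  split; split=> //; last by rewrite sA; case: gr => _ [-> _] _.
  - by move=> v g; rewrite frame.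
  - by case: qu => sQT sq; split=> [|i lt_i]; rewrite !frame //; exact: sq.
  - by rewrite frame.
apply: runs_seq; apply: (runs_conseq (runs_scan sc)) => c2 s2 [le_c2 [q' [D' [sc' tk nt le_q]]]].
apply: runs_loopfree => // c3 le_c3.
case: sc' => [[gr2 tab2 [sQT2 sq2] sQH2 lt_h'] [_ _ _ _ inv2]].
have frame' a : a \notin [:: aQH] -> run w (Incr aQH) s2 a =1 s2 a.
  by move=> na; apply: run_frame.
split; first by rewrite /state_cost; lia.
exists q', D'; split=> //; last first.
  by rewrite (scannedS _ _ s0) // /scanned tk nt.
split.
- by apply: rep_graph_frame gr2 => a a_in; apply: frame'; move: a a_in; apply/allP.
- by move=> v g; rewrite frame'.
- by split=> [|i lt_i]; rewrite !frame' //; exact: sq2.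
- by rewrite /= !evalE /update /= sQH2 const1 addn1 modn_small // -addn1 (size_fits inv2).
- by apply: bfs_advance inv2 _.
Qed.

Definition search_cost : nat :=
  maxcost (bfs_start t) + state_cost + (state_cost + arc_cost) + 6.

Lemma runs_bfs s :
  rep_graph s -> s aV 0 = s0 -> rep_table s (fun=> 0) ->
  runs w (bfs t) s (fun c s' => c <= search_cost * (K * M).+1 /\
    exists q D, [/\ rep_table s' D, rep_queue s' q, forall x, (0 < D x) = (x \in q),
      size q <= (K * M).+1 & uniq q /\ good_table I big s0 (fun v g => D (v, g))]).
Proof.
move=> gr sV tab; apply: runs_seq; apply: runs_loopfree => // c1 le_c1.
have [tab1 qu1 sQH1] := run_bfs_start (graph_big gr) sV tab.
have gr1 : rep_graph (run w (bfs_start t) s).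
  by apply: rep_graph_frame gr => a a_in; apply: run_frame => //; move: a a_in; apply/allP.
move: (run _ _ _) tab1 qu1 sQH1 gr1 => s1 tab1 qu1 sQH1 gr1.
(* An arc not yet scanned also carries a full [state_cost], released when it discovers a state and
   so lengthens the queue. *)
pose Inv p s' := exists q h D,
  [/\ searching s' q h D, size q <= (scanned asrc M q h).+1 &
      p = state_cost * (size q - h) + (state_cost + arc_cost) * (K * M - scanned asrc M q h)].
have start : Inv (state_cost + (state_cost + arc_cost) * (K * M)) s1.
  exists [:: x0], 0, (fun x => if x == x0 then big else 0).
  rewrite /scanned big_nil !subn0 muln1; split=> //; split=> //.
  exact: bfs_init.
apply: (runs_conseq (runs_while _ start)); last first.
  move=> c s' [p [[q [h [D [[gr' tab' qu' sQH' inv'] le_q _]]]] /= e0 le_c]].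
  have le_sc := scanned_le asrc M h (bfs_uniq inv').
  have eq_h : h = size q.
    by move: e0; rewrite !mod0n sQH'; case: qu' => -> _; have := bfs_h inv'; lia.
  split.
    move: le_c1 le_c; rewrite /search_cost.
    move: (maxcost _) state_cost arc_cost (K * M) => a b d e.
    clear; move=> *; nia.
  exists q, D; split=> //; first exact: (bfs_mem inv').
  - by apply: leq_trans le_q _; rewrite ltnS.
  - by rewrite eq_h in inv'; split; [exact: bfs_uniq inv' | apply: bfs_good inv'].
move=> p s' [q [h [D [se le_q ->]]]] /= e_n0.
have lt_h : h < size q.
  by move: e_n0; rewrite !mod0n; case: se => _ _ [-> _] -> _; lia.
apply: (runs_conseq (runs_search_step se lt_h)) => c s2 [le_c [q' [D' [se' sc' le_q']]]].
have le_sc : scanned asrc M q' h.+1 <= K * M.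
  by apply: scanned_le; case: se' => _ _ _ _ /bfs_uniq.
eexists; first by exists q', h.+1, D'; split=> //; lia.
have h' : h.+1 <= size q' by case: se' => _ _ _ _ /bfs_h.
rewrite sc' in le_sc *; set d := outdeg _ _ _ in le_c le_q' le_sc *.
have -> : K * M - scanned asrc M q h = (K * M - (scanned asrc M q h + d)) + d by lia.
apply: (@leq_trans (state_cost * (size q - h.+1 + d) +
  (state_cost + arc_cost) * (K * M - (scanned asrc M q h + d)) + (state_cost + arc_cost * d))).
  have : state_cost * (size q' - h.+1) <= state_cost * (size q - h.+1 + d).
    by rewrite leq_mul2l; apply/orP; right; lia.
  lia.
have -> : size q - h = (size q - h.+1).+1 by lia.
have arith a b c' e f : e * (a + c') + (e + f) * b + (e + f * c') <= e * a.+1 + (e + f) * (b + c').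
  by rewrite mulnS !mulnDr !mulnDl; lia.
exact: arith.
Qed.

Definition erase_cost : nat := maxcost (erase_next t) + 10.

Lemma runs_erase s q D :
  rep_table s D -> rep_queue s q -> (forall x, (0 < D x) = (x \in q)) -> uniq q ->
  runs w (erase t) s (fun c s' => c <= erase_cost * (size q).+1 /\ rep_table s' (fun=> 0)).
Proof.
move=> tab qu memq uq.
have size_q : size q <= K * n by rewrite mulnC -card_X -(card_uniqP uq) max_card.
apply: runs_seq; apply: runs_loopfree => // c1 le_c1.
pose Inv p s' := exists h,
  [/\ s' aQH 0 = h, h <= size q, rep_queue s' q, p = erase_cost * (size q - h) &
     rep_table s' (fun x => if x \in take h q then 0 else D x)].
have start : Inv (erase_cost * size q) (run w (Assign aQH (Const 0)) s).
  exists 0; rewrite subn0 take0; split=> //=; rewrite ?mod0n //.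
apply: (runs_conseq (runs_while _ start)); last first.
  move=> c s' [p [[h [sQH le_h [sQT _] _ tab']] /= e0 le_c]].
  have eq_h : h = size q by move: e0; rewrite !mod0n sQH sQT; lia.
  split; first by move: le_c1 le_c; rewrite mulnS /erase_cost /=; lia.
  by move=> v g; rewrite tab' eq_h take_size -memq; case: posnP.
move=> p s' [h [sQH le_h [sQT sq] -> tab']] /=; rewrite !mod0n sQH sQT => e_n0.
have lt_h : h < size q by lia.
have [sU sB] := sq _ lt_h.
apply: runs_loopfree => // c le_c.
exists (erase_cost * (size q - h.+1)); last first.
  have -> : size q - h = (size q - h.+1).+1 by lia.
  by rewrite mulnS /erase_cost; lia.
have ev b i : run w (erase_next t) s' b i =
    if (b == aQH) && (i == 0) then h.+1
    else if (b == aD) && (i == K * (nth x0 q h).1 + rk (nth x0 q h).2) then 0 else s' b i.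
  rewrite /= !evalE /= !evalE /update /= ?evalE sQH sU sB pair_mod const1 addn1 modn_small //.
  by move: fits; rewrite /max_value; lia.
exists h.+1; split; [by rewrite ev | exact: lt_h | | by [] | ].
- by split=> [|i lt_i]; rewrite !ev //=; exact: sq.
- move=> v g; rewrite ev /= (pair_inj (v, g)) tab' (take_nth x0) // mem_rcons inE.
  by case: eqP.
Qed.

(** [out] harvests the table of one search before it is erased. Since [out] leaves the queue alone,
    erasing takes time proportional to the queue and restores the all-zero table that the next
    search presupposes. *)
Lemma runs_sweep out s :
  loopfree out ->
  (forall a, a \in [:: aD; aQU; aQB; aQT] -> a \notin writes out) ->
  rep_graph s -> s aV 0 = s0 -> rep_table s (fun=> 0) ->
  runs w (bfs t ;; out ;; erase t) s (fun c s' =>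
    c <= maxcost out + (search_cost + 2 * erase_cost) * (K * M).+1 /\
    exists D s1, [/\ good_table I big s0 (fun v g => D (v, g)), rep_table s1 D,
      forall a, a \notin writes (bfs t) -> s1 a =1 s a,
      forall a, a \notin writes (erase t) -> s' a =1 run w out s1 a &
      rep_table s' (fun=> 0)]).
Proof.
move=> lf out_frame gr sV tab; apply: runs_seq.
apply: (runs_conseq (runs_frame (runs_bfs gr sV tab))) => c1 s1.
move=> [[le_c1 [q [D [tab1 [sQT sq] memq le_q [uq good]]]]] fr1].
apply: runs_seq; apply: runs_loopfree => // c2 le_c2.
have fr2 a : a \in [:: aD; aQU; aQB; aQT] -> run w out s1 a =1 s1 a.
  by move=> a_in; apply: run_frame => //; apply: out_frame.
have tab2 : rep_table (run w out s1) D by move=> v g; rewrite fr2.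
have qu2 : rep_queue (run w out s1) q by split=> [|i lt_i]; rewrite !fr2 //; exact: sq.
apply: (runs_conseq (runs_frame (runs_erase tab2 qu2 memq uq))) => c3 s3 [[le_c3 tab3] fr3].
split; last by exists D, s1.
have : erase_cost * (size q).+1 <= erase_cost * (2 * (K * M).+1).
  by rewrite leq_mul2l; apply/orP; right; lia.
by rewrite mulnDl; lia.
Qed.

End Simulation.

(** * Reading the input *)

Section Reading.

Variable t : nat.
Notation K := (nlab t).

Definition unitv (i : 'I_t) : lab t := delta_mx ord0 i.
Definition coord (x : lab t) (i : 'I_t) : nat := (x : 'rV['F_2]_t) ord0 i.

(** The input gives a label by its coordinates, while the program needs its rank; a running sum of
    unit vectors in the addition table converts one into the other. *)
Lemma lab_sum (x : lab t) :
  \big[@gadd t/gzero]_(i <- enum 'I_t) (if coord x i == 0 then gzero else unitv i) = x.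
Proof.
rewrite big_enum /= [RHS](row_sum_delta (x : 'rV_t)).
apply: eq_bigr => i _; rewrite /coord; have := ltn_ord ((x : 'rV['F_2]_t) ord0 i).
case: (_ ord0 i) => -[|[|//]] lt_2 _ /=.
  by rewrite (_ : Ordinal _ = 0%R) ?scale0r //; exact: val_inj.
by rewrite (_ : Ordinal _ = 1%R) ?scale1r //; exact: val_inj.
Qed.

Fixpoint read_coords (l : seq 'I_t) : cmd :=
  if l is i :: l' then
    If (Read aIn (Var aPos)) (Assign aG (Sum t (Var aG) (Const (rk (unitv i))))) Skip ;;
    Incr aPos ;;
    read_coords l'
  else Skip.

Definition read_label : cmd := Assign aG (Const (rk (@gzero t))) ;; read_coords (enum 'I_t).

Lemma loopfree_coords l : loopfree (read_coords l).
Proof. by elim: l. Qed.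

Lemma loopfree_read_label : loopfree read_label.
Proof. exact: loopfree_coords. Qed.

Lemma writes_read_label a : a \notin [:: aG; aPos] -> a \notin writes read_label.
Proof.
rewrite /read_label; elim: (enum 'I_t) => [|i l IHl] //=.
  by rewrite !inE; case: eqP.
by move=> na; move: (IHl na); rewrite /= !inE; move: na; rewrite !inE !negb_or => /andP[-> ->].
Qed.

(** [aA] is incremented before use: arcs are numbered from 1, since the link 0 ends a list. *)
Definition add_arc (x y : nat) : cmd :=
  Incr aA ;;
  Write aTo (Var aA) (Var y) ;;
  Write aLab (Var aA) (Var aG) ;;
  Write aNxt (Var aA) (Read aHead (Var x)) ;;
  Write aHead (Var x) (Var aA).

Definition add_edge : cmd :=
  Assign aU (Read aIn (Var aPos)) ;;
  Incr aPos ;;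
  Assign aY (Read aIn (Var aPos)) ;;
  Incr aPos ;;
  read_label ;;
  add_arc aU aY ;;
  add_arc aY aU ;;
  Incr aE.

Definition add_edges : cmd :=
  While (Defs.Sub (Read aIn (Const 1)) (Var aE)) add_edge.

(** With two terminals, cells 3 and 4 of the input hold them: the search starts at the first, and
    the row of the second is kept. *)
Definition copy_distances : cmd :=
  Fill aF (fun b => Read aD (Pair t (Read aIn (Const 4)) (Const b))) K.

Definition terminal_sweep : cmd :=
  Assign aV (Read aIn (Const 3)) ;; bfs t ;; copy_distances ;; erase t.

(** An entrywise maximum, by truncated subtraction, with the row of the source [aV] itself: the
    closed walks through it. *)
Definition improve_cycles : cmd :=
  Fill aC (fun b => Add (Read aC (Const b))
    (Defs.Sub (Read aD (Pair t (Var aV) (Const b))) (Read aC (Const b)))) K.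

Definition sweeps : cmd :=
  Assign aV (Const 0) ;;
  While (Defs.Sub (Read aIn (Const 0)) (Var aV))
    ((bfs t ;; improve_cycles ;; erase t) ;; Incr aV).

(** The maximum of F(b) and F(b + d) + C(d) - [big], where d is the [i]-th label and b + d is the
    label that d carries to b in characteristic 2. The result goes to a fresh array because, in
    place, F(b + d) might already be overwritten. *)
Definition combine (i : nat) : cmd :=
  Fill (aF + i.+1) (fun b => Add (Read (aF + i) (Const b))
    (Defs.Sub (Defs.Sub (Add (Read (aF + i) (Const (rk (unrk t b +v unrk t i))))
                             (Read aC (Const i))) (Var aBig))
              (Read (aF + i) (Const b)))) K.

Fixpoint combines (k : nat) : cmd :=
  if k is k'.+1 then combines k' ;; combine k' else Skip.

(** Without terminals the empty set is the initial join, whence the entry [big] at the zero label.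
    With a single terminal the row stays 0, which stands for infinity. *)
Definition prologue : cmd :=
  init_sums t ;;
  Assign aPos (Add (Const 3) (Read aIn (Const 2))) ;;
  read_label ;;
  Assign aTgt (Var aG) ;;
  Assign aBig (Add (Add (Scale K (Read aIn (Const 0))) (Read aIn (Const 1))) (Const 1)) ;;
  If (Read aIn (Const 2)) Skip (Write aF (Const (rk (@gzero t))) (Var aBig)).

Definition epilogue : cmd :=
  combines K ;;
  If (Read (aF + K) (Var aTgt))
    (Assign aOut (Add (Defs.Sub (Var aBig) (Read (aF + K) (Var aTgt))) (Const 1))) Skip.

(** For m = 0 the time bound is a constant, so the loop over the vertices has to be skipped. *)
Definition parity_join : cmd :=
  prologue ;;
  If (Read aIn (Const 1))
    (add_edges ;;
     If (Defs.Sub (Read aIn (Const 2)) (Const 1)) terminal_sweep Skip ;;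
     sweeps) Skip ;;
  epilogue.

End Reading.

Section ReadingCorrect.

Variables (t n m w : nat).
Notation K := (nlab t).
Hypothesis fits : K * K + 2 * max_value t n m + m * (t + 2) + t + 10 < 2 ^ w.

Lemma run_coords (l : seq 'I_t) (s : memory) (g x : lab t) p :
  rep_sums t s -> s aG 0 = rk g -> s aPos 0 = p -> p + size l < 2 ^ w ->
  (forall j, j < size l -> s aIn (p + j) = nth 0 [seq coord x i | i <- l] j) ->
  let s' := run w (read_coords l) s in
  s' aG 0 = rk (g +v \big[@gadd t/gzero]_(i <- l) (if coord x i == 0 then gzero else unitv i))
  /\ s' aPos 0 = p + size l.
Proof.
elim: l s g p => [|i l IHl] s g p sums sG sP fit_p inp.
  by rewrite big_nil gadd0 addn0.
have in0 := inp 0 isT; rewrite addn0 /= in in0.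
rewrite big_cons gaddA /= -addSnnS.
set s1 := (if _ then _ else _).
have s1P : forall b j, s1 b j =
    if (b == aG) && (j == 0) then rk (g +v (if coord x i == 0 then gzero else unitv i)) else s b j.
  move=> b j; rewrite /s1 !mod0n sP in0; case: eqP => [_ | _].
    by rewrite gadd0 -sG; case: ifP => // /andP[/eqP -> /eqP ->].
  by rewrite /update /= !evalE /= !evalE sG (rk_mod fits) (sum_mod fits) sums.
apply: IHl.
- by move=> y z; rewrite /update /= s1P; exact: sums.
- by rewrite /update /= s1P.
- rewrite /update /= !mod0n /= !s1P sP (const1 fits) addn1 modn_small //.
  by move: fit_p => /=; lia.
- by move: fit_p => /=; rewrite addSnnS.
- by move=> j lt_j; rewrite /update /= s1P addSnnS inp.
Qed.

Lemma run_read_label (s : memory) (x : 'rV['F_2]_t) p :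
  rep_sums t s -> s aPos 0 = p -> p + t < 2 ^ w ->
  (forall j, j < t -> s aIn (p + j) = nth 0 (encode_vector x) j) ->
  let s' := run w (read_label t) s in s' aG 0 = rk (x : lab t) /\ s' aPos 0 = p + t.
Proof.
move=> sums sP fit_p inp.
pose s1 := run w (Assign aG (Const (rk (@gzero t)))) s.
have s1P b i : b != aG -> s1 b i = s b i by rewrite /s1 /= /update => /negbTE ->.
have s1G : s1 aG 0 = rk (@gzero t) by rewrite /s1 /= /update /= !mod0n (rk_mod fits).
have /= := @run_coords (enum 'I_t) s1 gzero x p.
rewrite gadd0r lab_sum size_enum_ord; apply.
- by move=> y z; rewrite s1P //; exact: sums.
- exact: s1G.
- by rewrite s1P.
- exact: fit_p.
- by move=> j lt_j; rewrite s1P // inp.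
Qed.

End ReadingCorrect.

(** * The arcs built from the list of edges *)

Section Edges.

Variables (t n m : nat) (I : instance t n m).
Notation K := (nlab t).
Notation G := (lab t).
Variable e0 : 'I_m.

Definition edge (k : nat) : 'I_m := nth e0 (enum 'I_m) k.

Lemma edgeK (e : 'I_m) : edge e = e.
Proof. exact: nth_ord_enum. Qed.

(** Edge number k yields arc 2k + 1 in its stored direction and arc 2k + 2 in the reverse
    direction. *)
Definition asrc (a : nat) : 'I_n :=
  if odd a then (ends I (edge a./2)).1 else (ends I (edge a./2.-1)).2.
Definition ato (a : nat) : 'I_n :=
  if odd a then (ends I (edge a./2)).2 else (ends I (edge a./2.-1)).1.
Definition alab (a : nat) : G :=
  elab I (edge (if odd a then a./2 else a./2.-1)).

Lemma arcs_sound a : 0 < a <= 2 * m ->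
  exists2 e, adj I e (asrc a) (ato a) & elab I e = alab a.
Proof.
move=> _; rewrite /asrc /ato /alab /adj; case: (odd a).
  by exists (edge a./2); rewrite // -surjective_pairing eqxx.
by exists (edge a./2.-1); rewrite // -surjective_pairing eqxx orbT.
Qed.

Lemma arcs_complete e x y : adj I e x y ->
  exists a, [/\ 0 < a <= 2 * m, asrc a = x, ato a = y & alab a = elab I e].
Proof.
have lt_e := ltn_ord e.
rewrite /adj => /orP[] /eqP def_e.
  exists (2 * e).+1; rewrite /asrc /ato /alab /= mul2n odd_double /= uphalf_double edgeK def_e.
  by split=> //; lia.
exists (2 * e).+2; rewrite /asrc /ato /alab /= mul2n odd_double /= doubleK edgeK def_e.
by split=> //; lia.
Qed.

Variable w : nat.
Hypothesis fits : K * K + 2 * max_value t n m + m * (t + 2) + t + 10 < 2 ^ w.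

Lemma run_add_arc x y (s : memory) a :
  (x, y) \in [:: (aU, aY); (aY, aU)] -> a.+1 < 2 ^ w ->
  rep_arcs asrc ato alab s a -> s aA 0 = a ->
  s x 0 = asrc a.+1 -> s y 0 = ato a.+1 -> s aG 0 = rk (alab a.+1) ->
  let s' := run w (add_arc x y) s in rep_arcs asrc ato alab s' a.+1 /\ s' aA 0 = a.+1.
Proof.
move=> xy fit_a [hd arcs] sA sx sy sg.
have ev b i : run w (add_arc x y) s b i =
    if (b == aHead) && (i == asrc a.+1) then a.+1
    else if (b == aNxt) && (i == a.+1) then s aHead (asrc a.+1)
    else if (b == aLab) && (i == a.+1) then rk (alab a.+1)
    else if (b == aTo) && (i == a.+1) then ato a.+1 : nat
    else if (b == aA) && (i == 0) then a.+1
    else s b i.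
  have w1 := const1 fits.
  move: xy; rewrite !inE => /orP[] /eqP[ex ey]; subst x y;
    by rewrite /= !evalE /update /= ?mod0n w1 sA addn1 modn_small // sx sy sg.
split; last by rewrite ev.
split=> [u | b /andP[b_gt0 le_b]].
  rewrite ev /= hd eq_sym; rewrite -(inj_eq val_inj) /=; by case: eqP.
rewrite !ev /=; move: le_b; rewrite leq_eqVlt ltnS => /orP[/eqP -> | le_b].
  by rewrite eqxx /= hd.
by rewrite ltn_eqF //=; apply: arcs; rewrite b_gt0.
Qed.

Variables (inp : nat -> nat) (base : nat).
Hypothesis inp_m : inp 1 = m.
Hypothesis inp_edge : forall e : 'I_m,
  [/\ inp (base + e * (t + 2)) = (ends I e).1, inp (base + e * (t + 2) + 1) = (ends I e).2 &
    forall j, j < t -> inp (base + e * (t + 2) + 2 + j) = nth 0 (encode_vector (label I e)) j].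
Hypothesis base_le : base <= t + 5.

Definition reading (s : memory) (k : nat) : Prop :=
  [/\ s aIn =1 inp, rep_sums t s, rep_arcs asrc ato alab s (2 * k), s aA 0 = 2 * k &
    s aE 0 = k /\ s aPos 0 = base + k * (t + 2)].

Lemma run_add_edge s k : k < m -> reading s k -> reading (run w (add_edge t) s) k.+1.
Proof.
move=> lt_k [sI sums arcs sA [sE sP]].
have w1 := const1 fits.
have k_e : k = edge k by rewrite /edge nth_enum_ord.
have [i1 i2 i3] := inp_edge (edge k); rewrite -k_e in i1 i2 i3.
have pos_le : base + k * (t + 2) + (t + 2) < 2 ^ w.
  have : k.+1 * (t + 2) <= m * (t + 2) by rewrite leq_mul2r lt_k orbT.
  by move: fits; rewrite mulSn; lia.
have odd1 : odd (2 * k).+1 by rewrite /= mul2n odd_double.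
have half1 : (2 * k).+1./2 = k by rewrite /= mul2n uphalf_double.
have half2 : (2 * k).+2./2.-1 = k by rewrite /= mul2n doubleK.
pose c1 := Assign aU (Read aIn (Var aPos)) ;; Incr aPos ;;
  Assign aY (Read aIn (Var aPos)) ;; Incr aPos.
pose s1 := run w c1 s.
have ev b i : s1 b i = if (b == aPos) && (i == 0) then base + k * (t + 2) + 2
    else if (b == aY) && (i == 0) then (ends I (edge k)).2 : nat
    else if (b == aU) && (i == 0) then (ends I (edge k)).1 : nat else s b i.
  have p1 : (base + k * (t + 2) + 1) %% 2 ^ w = base + k * (t + 2) + 1.
    by rewrite modn_small //; lia.
  have p2 : (base + k * (t + 2) + 1 + 1) %% 2 ^ w = base + k * (t + 2) + 2.
    by rewrite modn_small //; lia.
  rewrite /s1 /= !mod0n /update /= ?mod0n /= !sP w1 !p1 p2 !sI i1 i2.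
  by case: (b == aPos) => //=; case: (i == 0).
have [||||s2G s2P] := @run_read_label t n m w fits s1 (label I (edge k)) (base + k * (t + 2) + 2).
- by move=> x y; rewrite ev; exact: sums.
- by rewrite ev.
- by rewrite -addnA; lia.
- by move=> j lt_j; rewrite ev /= sI i3.
have fr2 b : b \notin [:: aG; aPos] -> run w (read_label t) s1 b =1 s1 b.
  by move=> nb; apply: run_frame; [exact: loopfree_read_label | exact: writes_read_label].
have [s2 def_s2] : exists s2, run w (read_label t) s1 = s2 by eexists.
rewrite def_s2 in s2G s2P fr2.
have [|||||||arcs3 s3A] := @run_add_arc aU aY s2 (2 * k).
- by [].
- by move: fits; rewrite /max_value; lia.
- by case: arcs => hd ar; split=> [u|a a_le]; rewrite !fr2 // !ev //=; exact: ar.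
- by rewrite fr2 // ev.
- by rewrite fr2 // ev /= /asrc odd1 half1.
- by rewrite fr2 // ev /= /ato odd1 half1.
- by rewrite s2G /alab odd1 half1.
have fr3 b : b \notin [:: aA; aTo; aLab; aNxt; aHead] -> run w (add_arc aU aY) s2 b =1 s2 b.
  by move=> nb; apply: run_frame.
have [s3 def_s3] : exists s3, run w (add_arc aU aY) s2 = s3 by eexists.
rewrite def_s3 in arcs3 s3A fr3.
have even2 : odd (2 * k).+2 = false by rewrite /= mul2n odd_double.
have [|||||||arcs4 s4A] := @run_add_arc aY aU s3 (2 * k).+1.
- by [].
- by move: fits; rewrite /max_value; lia.
- exact: arcs3.
- exact: s3A.
- by rewrite fr3 // fr2 // ev /= /asrc even2 half2.
- by rewrite fr3 // fr2 // ev /= /ato even2 half2.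
- by rewrite fr3 // s2G /alab even2 half2.
have fr4 b : b \notin [:: aA; aTo; aLab; aNxt; aHead] -> run w (add_arc aY aU) s3 b =1 s3 b.
  by move=> nb; apply: run_frame.
have -> : run w (add_edge t) s = run w (Incr aE) (run w (add_arc aY aU) s3).
  by rewrite -def_s3 -def_s2.
move: (run w (add_arc aY aU) s3) arcs4 s4A fr4 => s4 arcs4 s4A fr4.
have ev5 b i : run w (Incr aE) s4 b i = if (b == aE) && (i == 0) then k.+1 else s4 b i.
  rewrite /= /update /= !mod0n w1 fr4 // fr3 // fr2 // ev /= sE addn1 modn_small //.
  by move: fits; rewrite /max_value; lia.
rewrite /reading (_ : 2 * k.+1 = (2 * k).+2); last by lia.
split.
- by move=> i; rewrite ev5 /= fr4 // fr3 // fr2 // ev; exact: sI.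
- by move=> x y; rewrite ev5 /= fr4 // fr3 // fr2 // ev; exact: sums.
- by case: arcs4 => hd ar; split=> [u|a a_le]; rewrite !ev5 /=; [exact: hd | exact: ar].
- by rewrite ev5.
- by rewrite !ev5 /= fr4 // fr3 // s2P mulSn; split=> //; lia.
Qed.

Definition edge_cost : nat := maxcost (add_edge t) + 10.

Lemma loopfree_add_edge : loopfree (add_edge t).
Proof. by rewrite /= loopfree_coords. Qed.

Lemma runs_add_edges s :
  reading s 0 ->
  runs w (add_edges t) s (fun c s' => c <= edge_cost * m.+1 /\ reading s' m).
Proof.
move=> start.
pose Inv p s' := exists k, [/\ reading s' k, k <= m & p = edge_cost * (m - k)].
have start' : Inv (edge_cost * m) s by exists 0; rewrite subn0.
have w1 := const1 fits.
apply: (runs_conseq (runs_while _ start')); last first.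
  move=> c s' [p [[k [rd le_k _]] /= e_0 le_c]].
  have eq_k : k = m.
    by move: e_0; case: rd => sI _ _ _ [sE _]; rewrite !mod0n w1 sE sI inp_m; lia.
  rewrite eq_k in rd; split=> //; rewrite mulnS /edge_cost; move: le_c; rewrite /edge_cost; lia.
move=> p s' [k [rd le_k ->]] /= e_n0.
have lt_k : k < m.
  by move: e_n0; case: rd => sI _ _ _ [sE _]; rewrite !mod0n w1 sE sI inp_m; lia.
apply: runs_loopfree => [|c le_c]; first exact: loopfree_add_edge.
exists (edge_cost * (m - k.+1)).
  by exists k.+1; split=> //; exact: run_add_edge.
have -> : m - k = (m - k.+1).+1 by lia.
by rewrite mulnS /edge_cost; lia.
Qed.

End Edges.

(** * The sweeps and the final dynamic program *)

Section Sweeps.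

Variables (t n m : nat) (I : instance t n m).
Notation K := (nlab t).
Notation G := (lab t).
Notation big := (max_value t n m).

Lemma realizes_le b (g : G) z : realizes I big b g z -> z <= big.
Proof. by move=> [J [_ _]]; lia. Qed.

Lemma card_states : #|{: 'I_n * G}| < big.
Proof. by rewrite card_X /max_value mulnC; lia. Qed.

Definition sound_row (s : memory) (a : nat) (b : 'I_n -> bool) : Prop :=
  forall g : G, 0 < s a (rk g) -> realizes I big b g (s a (rk g)).

Lemma sound_row_le s a b (g : G) : sound_row s a b -> s a (rk g) <= big.
Proof. by move=> snd; case: (posnP (s a (rk g))) => [-> | /snd /realizes_le]. Qed.

Lemma good_table_le s0 D y g : good_table I big s0 D -> D y g <= big.
Proof. by move=> [_ _ snd]; case: (posnP (D y g)) => [-> | /snd /realizes_le]. Qed.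

Variable w : nat.
Hypothesis fits : K * K + 2 * big + m * (t + 2) + t + 10 < 2 ^ w.

Section WithEdges.

Variable e0 : 'I_m.
Notation graph := (rep_graph m (asrc I e0) (ato I e0) (alab I e0) (2 * m)).
Notation volume := (K * (2 * m)).+1.

Definition terminal_cost : nat :=
  maxcost (copy_distances t) + search_cost t + 2 * erase_cost t + 10.

Lemma const_mod k : k <= 10 -> k %% 2 ^ w = k.
Proof. by move=> le_k; rewrite modn_small //; move: fits; lia. Qed.

Lemma K_le_word : K <= 2 ^ w.
Proof.
by have := leq_pmulr K (leq_ltn_trans (leq0n _) (rk_lt (@gzero t))); move: fits; lia.
Qed.

Lemma runs_terminal_sweep s (u v : 'I_n) :
  graph s -> rep_table s (fun _ : 'I_n * G => 0) -> s aIn 3 = u -> s aIn 4 = v ->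
  runs w (terminal_sweep t) s (fun c s' => c <= terminal_cost * volume /\
    [/\ graph s', rep_table s' (fun _ : 'I_n * G => 0) & exists2 D,
      good_table I big u D & forall g, s' aF (rk g) = D v g]).
Proof.
move=> gr tab su sv; apply: runs_seq; apply: runs_loopfree => // c1 le_c1.
have fr1 b : b != aV -> run w (Assign aV (Read aIn (Const 3))) s b =1 s b.
  by move=> nb; apply: run_frame; rewrite //= inE.
have s1V : run w (Assign aV (Read aIn (Const 3))) s aV 0 = u.
  by rewrite /= /update /= !mod0n const_mod.
move: (run _ _ _) fr1 s1V => s1 fr1 s1V.
have gr1 : graph s1.
  by apply: rep_graph_frame gr => a a_in; apply: fr1; move: a a_in; apply/allP.
have tab1 : rep_table s1 (fun _ : 'I_n * G => 0) by move=> x g; rewrite fr1.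
have wr a : a \in [:: aD; aQU; aQB; aQT] -> a \notin writes (copy_distances t).
  by rewrite !inE => a_in; apply: writes_Fill; move: a_in; do !case: eqP => [-> | _] //.
have := runs_sweep (arcs_sound I e0) (@arcs_complete _ _ _ I e0) fits card_states
  (loopfree_Fill _ _ _) wr gr1 s1V tab1.
move=> rs; apply: (runs_conseq rs) => c2 s' [le_c2 [D [s2 [good tab2 fr2 fr3 tab3]]]].
split.
  have arith p q r v' : c2 <= p + (q + 2 * r) * v'.+1 -> c1 + c2 <= (p + q + 2 * r + 10) * v'.+1.
    by move: le_c1 => /= le1 le2; rewrite !mulnDl; have := leq_pmulr p (ltn0Sn v'); lia.
  exact: arith.
have evF b i : b \notin writes (erase t) -> s' b i =
    if (b == aF) && (i < K) then eval w s2 (Read aD (Pair t (Read aIn (Const 4)) (Const i)))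
    else s2 b i.
  by move=> nb; rewrite fr3 // run_Fill ?K_le_word // => s3 j _ h; rewrite /= !evalE /= !h.
split=> //.
  apply: rep_graph_frame gr1 => a a_in i.
  have a_ne : a != aF by move: a a_in; apply/allP.
  rewrite evF; last by move: a a_in {a_ne}; apply/allP.
  by rewrite (negbTE a_ne) /=; apply: fr2; move: a a_in {a_ne}; apply/allP.
exists (fun x g => D (x, g)) => // g.
rewrite evF // eqxx rk_lt /= !evalE /= (const_mod (k := 4)) // (rk_mod fits).
by rewrite (fr2 aIn) // fr1 // sv (pair_mod fits) tab2.
Qed.

Definition cycle_rows (s : memory) (k : nat) : Prop :=
  sound_row s aC xpred0 /\
  forall v : 'I_n, v < k -> exists2 D,
    good_table I big v D & forall g, D v g <= s aC (rk g).

Definition sweep_cost : nat :=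
  maxcost (improve_cycles t) + search_cost t + 2 * erase_cost t + 40.

Lemma runs_sweeps s :
  graph s -> rep_table s (fun _ : 'I_n * G => 0) -> s aIn 0 = n ->
  (forall g : G, s aC (rk g) = 0) ->
  runs w (sweeps t) s (fun c s' => c <= sweep_cost * (n.+1 * volume) /\ cycle_rows s' n).
Proof.
move=> gr tab sn sC; apply: runs_seq; apply: runs_loopfree => // c1 le_c1.
have fr1 b : b != aV -> run w (Assign aV (Const 0)) s b =1 s b.
  by move=> nb; apply: run_frame; rewrite //= inE.
have s1V : run w (Assign aV (Const 0)) s aV 0 = 0 by rewrite /= /update /= !mod0n.
move: (run _ _ _) fr1 s1V => s1 fr1 s1V.
have gr1 : graph s1.
  by apply: rep_graph_frame gr => a a_in; apply: fr1; move: a a_in; apply/allP.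
pose Inv p s' := exists k, [/\ graph s' /\ s' aIn 0 = n, rep_table s' (fun _ : 'I_n * G => 0),
  s' aV 0 = k /\ k <= n, cycle_rows s' k & p = (sweep_cost - 10) * ((n - k) * volume)].
have start : Inv ((sweep_cost - 10) * (n * volume)) s1.
  exists 0; rewrite subn0; split=> //; first by rewrite fr1.
    by move=> x g; rewrite fr1.
  by split=> // g; rewrite fr1 // sC.
apply: (runs_conseq (runs_while _ start)); last first.
  move=> c s' [p [[k [[_ sn'] _ [sV le_k] cyc _]] /= e0_ le_c]].
  have eq_k : k = n by move: e0_; rewrite !mod0n sn' sV; lia.
  rewrite eq_k in cyc; split=> //.
  have arith a v' : c <= (a + 40 - 10) * (n * v'.+1) + 9 -> c1 + c <= (a + 40) * (n.+1 * v'.+1).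
    move=> le2; have -> : (a + 40) * (n.+1 * v'.+1) =
      (a + 40 - 10) * (n * v'.+1) + 10 * (n * v'.+1) + (a + 40) * v'.+1.
      by rewrite mulSn mulnDr (_ : a + 40 - 10 = a + 30); [lia | lia].
    have : 20 * v'.+1 <= (a + 40) * v'.+1 by rewrite leq_mul2r; apply/orP; right; lia.
    by move: le_c1 => /= le1; lia.
  by apply: arith; rewrite -/sweep_cost; lia.
move=> p s' [k [[gr' sn'] tab' [sV le_k] [sndC cyc] ->]] /= e_n0.
have lt_k : k < n by move: e_n0; rewrite !mod0n sn' sV; lia.
pose v := Ordinal lt_k.
have sV' : s' aV 0 = v by [].
have wr a : a \in [:: aD; aQU; aQB; aQT] -> a \notin writes (improve_cycles t).
  by rewrite !inE => a_in; apply: writes_Fill; move: a_in; do !case: eqP => [-> | _] //.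
apply: runs_seq.
have := runs_sweep (arcs_sound I e0) (@arcs_complete _ _ _ I e0) fits card_states
  (loopfree_Fill _ _ _) wr gr' sV' tab'.
move=> rs; apply: (runs_conseq rs) => c2 s2 [le_c2 [D [s3 [good tab3 fr3 fr2 tab2]]]].
apply: runs_loopfree => // c4 le_c4.
have ev2 b i : b \notin writes (erase t) -> s2 b i =
    if (b == aC) && (i < K) then eval w s3 (Add (Read aC (Const i))
      (Defs.Sub (Read aD (Pair t (Var aV) (Const i))) (Read aC (Const i))))
    else s3 b i.
  move=> nb; rewrite fr2 // run_Fill ?K_le_word // => s5 j lt_j h /=.
  have jw : j %% 2 ^ w = j by rewrite modn_small //; exact: leq_trans K_le_word.
  by rewrite !evalE /= !h // jw leqnn orbT.
have ev4 b i : run w (Incr aV) s2 b i = if (b == aV) && (i == 0) then k.+1 else s2 b i.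
  have le_n : n <= K * n by rewrite leq_pmull // (leq_ltn_trans (leq0n _) (rk_lt (@gzero t))).
  rewrite /= /update /= !mod0n (const1 fits) ev2 //= fr3 // sV addn1 modn_small //.
  by move: fits; rewrite /max_value; lia.
move: (run w (Incr aV) s2) ev4 => s4 ev4.
have le_C (g : G) := sound_row_le g sndC.
have sC4 (g : G) : s4 aC (rk g) = s' aC (rk g) + (D (v, g) - s' aC (rk g)).
  rewrite ev4 /= ev2 // eqxx rk_lt /= !evalE /= !mod0n (rk_mod fits) (fr3 aC) // (fr3 aV) // sV'.
  rewrite (pair_mod fits) tab3 modn_small //.
  have := good_table_le v g good; have := le_C g; move: fits; lia.
eexists.
  exists k.+1; split.
  - split; last by rewrite ev4 /= ev2 //= fr3.
    apply: rep_graph_frame gr' => a a_in i.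
    rewrite ev4 ev2; last by move: a a_in; apply/allP.
    have : a != aC by move: a a_in; apply/allP.
    have : a != aV by move: a a_in; apply/allP.
    by move=> /negbTE -> /negbTE -> /=; apply: fr3; move: a a_in; apply/allP.
  - by move=> x g; rewrite ev4 /= tab2.
  - by rewrite ev4.
  - split.
      move=> g; rewrite sC4 => pos.
      have [le_D | lt_D] := leqP (D (v, g)) (s' aC (rk g)).
        by move: pos; rewrite (eqP le_D) addn0; exact: sndC.
      rewrite subnKC ?(ltnW lt_D) //.
      case: good => _ _ /(_ v g) snd; apply: eq_realizes (snd _); last exact: leq_ltn_trans lt_D.
      by move=> x; rewrite addbb.
    move=> x; rewrite ltnS leq_eqVlt => /orP[/eqP x_k | /cyc[D' good' leD']].
      have -> : x = v by apply: val_inj.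
      by exists (fun y g => D (y, g)) => // g; rewrite sC4; lia.
    by exists D' => // g; rewrite sC4; apply: leq_trans (leD' g) (leq_addr _ _).
  - by [].
have arith a q r j v' : c2 <= a + (q + 2 * r) * v'.+1 ->
    (a + q + 2 * r + 40 - 10) * (j * v'.+1) + (c2 + c4) + 6 <=
    (a + q + 2 * r + 40 - 10) * (j.+1 * v'.+1).
  move=> le2; rewrite (_ : a + q + 2 * r + 40 - 10 = a + (q + 2 * r) + 30); last by lia.
  by have := leq_pmulr a (ltn0Sn v'); move: le_c4 => /= le4; lia.
have -> : n - k = (n - k.+1).+1 by lia.
exact: arith.
Qed.

End WithEdges.

(** * The final dynamic program *)

Definition relaxed (s : memory) (a : nat) (y : G) : Prop :=
  forall x : G, s a (rk (x +v y)) + s aC (rk y) <= s a (rk x) + big.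

(** Closure under [y] survives the relaxation by d because labels commute: the inequality at x + d
    carries over to the new candidate at x. Closure under d holds because d + d = 0 and C(d) <=
    [big], so relaxing by d twice gains nothing. *)
Lemma run_combine i s b :
  i < K -> s aBig 0 = big -> sound_row s aC xpred0 -> sound_row s (aF + i) b ->
  let s' := run w (combine t i) s in
  [/\ sound_row s' (aF + i.+1) b,
      forall g : G, s (aF + i) (rk g) <= s' (aF + i.+1) (rk g),
      forall y, relaxed s (aF + i) y -> relaxed s' (aF + i.+1) y,
      relaxed s' (aF + i.+1) (unrk t i) &
      forall a, a != aF + i.+1 -> s' a =1 s a].
Proof.
move=> lt_i sbig sndC sndF.
set d := unrk t i; set s' := run _ _ _.
have fr a : a != aF + i.+1 -> s' a =1 s a.
  by move=> na; apply: run_frame; [exact: loopfree_Fill | exact: writes_Fill].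
have ev (g : G) : s' (aF + i.+1) (rk g) = s (aF + i) (rk g) +
    (s (aF + i) (rk (g +v d)) + s aC (rk d) - big - s (aF + i) (rk g)).
  have leK := K_le_word.
  have i_d : i %% 2 ^ w = rk d by rewrite modn_small ?unrkK //; exact: leq_trans leK.
  have neF : (aF + i == aF + i.+1) = false by rewrite eqn_add2l ltn_eqF.
  have neC : (aC == aF + i.+1) = false by [].
  have neB : (aBig == aF + i.+1) = false by [].
  rewrite /s' run_Fill //; last first.
    by move=> s2 j _ h /=; rewrite !h ?neF ?neC ?neB.
  rewrite eqxx rk_lt [eval _ _ _]/= !mod0n !(rk_mod fits) sbig rkK -/d i_d.
  have leF x := sound_row_le x sndF; have leC := sound_row_le d sndC.
  have := leF g; have := leF (g +v d) => le1 le2.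
  by rewrite [X in X - big - _]modn_small ?modn_small //; move: fits; lia.
split=> //.
- move=> g; rewrite ev => pos.
  have [le_F | lt_F] := leqP (s (aF + i) (rk (g +v d)) + s aC (rk d) - big) (s (aF + i) (rk g)).
    rewrite (eqP le_F) addn0; apply: sndF; move: pos; lia.
  have -> : s (aF + i) (rk g) + (s (aF + i) (rk (g +v d)) + s aC (rk d) - big - s (aF + i) (rk g))
     = s (aF + i) (rk (g +v d)) + s aC (rk d) - big by lia.
  have leF := sound_row_le (g +v d) sndF; have leC := sound_row_le d sndC.
  rewrite -{1}(gaddvK g d); apply: eq_realizes (realizes_add _ (sndF (g +v d) _) (sndC d _)).
  - by move=> v; rewrite addbF.
  - by lia.
  - by lia.
  - by lia.
- by move=> g; rewrite ev leq_addr.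
- move=> y cl x; rewrite !ev (fr aC) //.
  have c1 := cl x; have := cl (x +v d); rewrite -!gaddA (gaddC d y); lia.
- move=> x; rewrite !ev (fr aC) // gaddvK.
  by have leC := sound_row_le d sndC; lia.
Qed.

Lemma run_combines k s b :
  k <= K -> s aBig 0 = big -> sound_row s aC xpred0 -> sound_row s aF b ->
  let s' := run w (combines t k) s in
  [/\ sound_row s' (aF + k) b,
      forall g : G, s aF (rk g) <= s' (aF + k) (rk g),
      forall i, i < k -> relaxed s' (aF + k) (unrk t i) &
      forall a, a <= aF -> s' a =1 s a].
Proof.
elim: k => [|k IHk] lt_k sbig sndC sndF /=; first by rewrite addn0; split.
have [snd1 le1 rel1 fr1] := IHk (ltnW lt_k) sbig sndC sndF.
move: (run _ _ _) snd1 le1 rel1 fr1 => s1 snd1 le1 rel1 fr1.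
have [||snd2 le2 rel2 new2 fr2] := run_combine (s := s1) (b := b) lt_k _ _ snd1.
- by rewrite fr1.
- by move=> g; rewrite fr1 //; exact: sndC.
split=> //.
- by move=> g; apply: leq_trans (le1 g) (le2 g).
- by move=> i; rewrite ltnS leq_eqVlt => /orP[/eqP -> | /rel1 /rel2].
- by move=> a le_a i; rewrite fr2 ?fr1 //; apply: contraTneq le_a => ->; rewrite -ltnNge; lia.
Qed.

End Sweeps.

(** * Positions in the input, and the state after the prologue *)

Lemma nth_flatten_uniform (T : eqType) (f : T -> seq nat) (x : T) (l : seq T) (k i j : nat) :
  (forall y, size (f y) = k) -> i < size l -> j < k ->
  nth 0 (flatten (map f l)) (i * k + j) = nth 0 (f (nth x l i)) j.
Proof.
move=> sf; elim: l i => // y l IHl [|i] lt_i lt_j /=; rewrite nth_cat sf.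
  by rewrite mul0n add0n lt_j.
rewrite mulSn -addnA ltnNge leq_addr /= addKn; exact: IHl.
Qed.

Section Input.

Variables (t n m : nat) (I : instance t n m).
Notation K := (nlab t).
Notation G := (lab t).
Notation big := (max_value t n m).

Definition inp (i : nat) : nat := nth 0 (encode I) i.
Definition base : nat := 3 + #|terminals I| + t.

Lemma size_encode_vector (x : 'rV['F_2]_t) : size (encode_vector x) = t.
Proof. by rewrite size_map size_enum_ord. Qed.

Lemma inp_terminal j : j < #|terminals I| ->
  inp (3 + j) = nth 0 [seq nat_of_ord v | v <- enum (terminals I)] j.
Proof. by move=> lt_j; rewrite /inp /encode /= nth_cat size_map -cardE lt_j. Qed.

Lemma inp_target j : j < t ->
  inp (3 + #|terminals I| + j) = nth 0 (encode_vector (target I)) j.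
Proof.
move=> lt_j; rewrite /inp /encode -addnA /= nth_cat size_map -cardE ltnNge leq_addr /=.
by rewrite add0n addKn nth_cat size_encode_vector lt_j.
Qed.

Lemma inp_record (e : 'I_m) j : j < t + 2 ->
  inp (base + e * (t + 2) + j) =
  nth 0 ([:: nat_of_ord (ends I e).1; nat_of_ord (ends I e).2] ++ encode_vector (label I e)) j.
Proof.
move=> lt_j; rewrite /inp /encode /base -!addnA /= nth_cat size_map -cardE ltnNge leq_addr /=.
rewrite add0n addKn nth_cat size_encode_vector ltnNge leq_addr /= addKn.
rewrite (@nth_flatten_uniform _ _ e) ?size_enum_ord ?nth_ord_enum //.
by move=> y; rewrite /= size_encode_vector addn2.
Qed.

Lemma inp_edge (e : 'I_m) :
  [/\ inp (base + e * (t + 2)) = (ends I e).1, inp (base + e * (t + 2) + 1) = (ends I e).2 &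
    forall j, j < t -> inp (base + e * (t + 2) + 2 + j) = nth 0 (encode_vector (label I e)) j].
Proof.
split=> [||j lt_j].
- by have := @inp_record e 0; rewrite addn0 => ->; rewrite // addn2.
- by rewrite inp_record // addn2.
- by rewrite -addnA inp_record //; lia.
Qed.

Lemma two_terminals : #|terminals I| = 2 -> exists u v : 'I_n,
  [/\ terminals I =i (fun x => (x == u) (+) (x == v)), u != v, inp 3 = u & inp 4 = v].
Proof.
move=> card2; have i3 := @inp_terminal 0; have i4 := @inp_terminal 1.
move: i3 i4 (mem_enum (terminals I)) (enum_uniq (terminals I)) (cardE (terminals I)).
rewrite card2; case: (enum _) => [|u [|v [|]]] //= i3 i4 mem_uv uv _.
exists u, v; move: uv; rewrite inE andbT => neq; split; rewrite ?i3 ?i4 //.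
move=> x; rewrite -mem_uv !inE -[in RHS]topredE /=.
by have [-> | _] := eqVneq x u; rewrite ?(negbTE neq).
Qed.

Variable w : nat.
Hypothesis fits : K * K + 2 * big + m * (t + 2) + t + 10 < 2 ^ w.
Hypothesis terminals_le2 : #|terminals I| <= 2.

Lemma run_prologue :
  let s := run w (prologue t) (initial (encode I)) in
  [/\ s aIn =1 inp, rep_sums t s, s aPos 0 = base, s aTgt 0 = rk (target I : G) & s aBig 0 = big] /\
  (forall g : G, s aF (rk g) = if (#|terminals I| == 0) && (g == gzero) then big else 0) /\
  (forall a, a \notin [:: aIn; aTab; aPos; aG; aTgt; aBig; aF] -> forall i, s a i = 0).
Proof.
pose s0 := initial (encode I).
pose s1 := run w (init_sums t) s0.
have fr1 b : b != aTab -> s1 b =1 s0 b.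
  by move=> nb; apply: run_frame; [exact: loopfree_Fill | exact: writes_Fill].
have sums1 : rep_sums t s1 by apply: run_init_sums fits _.
pose s2 := run w (Assign aPos (Add (Const 3) (Read aIn (Const 2)))) s1.
have ev2 b i : s2 b i = if (b == aPos) && (i == 0) then 3 + #|terminals I| else s1 b i.
  rewrite /s2 /= /update /= !mod0n (const_mod fits (k := 3)) // (const_mod fits (k := 2)) // fr1 //.
  by rewrite (_ : s0 aIn 2 = #|terminals I|) // modn_small //; move: fits; lia.
have [||||s3G s3P] := @run_read_label t n m w fits s2 (target I) (3 + #|terminals I|).
- by move=> x y; rewrite ev2; exact: sums1.
- by rewrite ev2.
- by move: fits; lia.
- by move=> j lt_j; rewrite ev2 /= fr1 //; exact: inp_target.
have fr3 b : b \notin [:: aG; aPos] -> run w (read_label t) s2 b =1 s2 b.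
  by move=> nb; apply: run_frame; [exact: loopfree_read_label | exact: writes_read_label].
have -> : run w (prologue t) (initial (encode I)) =
  run w (Assign aTgt (Var aG) ;;
  Assign aBig (Add (Add (Scale K (Read aIn (Const 0))) (Read aIn (Const 1))) (Const 1)) ;;
  If (Read aIn (Const 2)) Skip (Write aF (Const (rk (@gzero t))) (Var aBig)))
  (run w (read_label t) s2) by [].
move: (run w (read_label t) s2) s3G s3P fr3 => s3 s3G s3P fr3.
have inp3 i : s3 aIn i = inp i by rewrite fr3 // ev2 /= fr1.
have ev4 b i : run w (Assign aTgt (Var aG) ;;
  Assign aBig (Add (Add (Scale K (Read aIn (Const 0))) (Read aIn (Const 1))) (Const 1)) ;;
  If (Read aIn (Const 2)) Skip (Write aF (Const (rk (@gzero t))) (Var aBig))) s3 b i =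
  if [&& #|terminals I| == 0, b == aF & i == rk (@gzero t)] then big
  else if (b == aBig) && (i == 0) then big
  else if (b == aTgt) && (i == 0) then rk (target I : G)
  else s3 b i.
  have bigE : (((K * n) %% 2 ^ w + m) %% 2 ^ w + 1) %% 2 ^ w = big.
    by rewrite !modn_small /max_value //; move: fits; rewrite /max_value; lia.
  rewrite /= !mod0n (const1 fits) (const_mod fits (k := 2)) // /update /= !eval_Scale /= !mod0n /=.
  rewrite !inp3 bigE s3G (rk_mod fits).
  rewrite (_ : inp 2 = #|terminals I|) //; case: (#|terminals I| == 0) => //=.
move: (run w _ s3) ev4 => s4 ev4; do !split.
- by move=> i; rewrite ev4 /= andbF.
- by move=> x y; rewrite ev4 /= andbF fr3 // ev2; exact: sums1.
- by rewrite ev4 /= andbF.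
- by rewrite ev4 /= andbF.
- by rewrite ev4 /= andbF.
- move=> g; rewrite ev4 /= (inj_eq (@rk_inj t)); case: ifP => // _.
  by rewrite fr3 // ev2 /= fr1.
- move=> a; rewrite !inE !negb_or => /and5P[n0 n2 n4 n3 /and3P[n5 n12 n25]] i.
  rewrite ev4 (negbTE n25) (negbTE n12) (negbTE n5) andbF /=.
  rewrite fr3 ?inE ?negb_or ?n3 // ev2 (negbTE n4) /= fr1 // /s0 /initial (negbTE n0) //.
Qed.

End Input.

(** * The whole program *)

Lemma notin_all (a : nat) (l L : seq nat) : a \notin L -> all [in L] l -> a \notin l.
Proof. by move=> na /allP sub; apply: contra na => /sub. Qed.

Lemma notin_cat (a : nat) (l1 l2 : seq nat) : a \notin l1 -> a \notin l2 -> a \notin l1 ++ l2.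
Proof. by move=> n1 n2; rewrite mem_cat negb_or n1. Qed.

Lemma writes_add_edges t a :
  a \notin [:: aU; aPos; aY; aG; aA; aTo; aLab; aNxt; aHead; aE] ->
  a \notin writes (add_edges t).
Proof.
move=> na; have -> : writes (add_edges t) = [:: aU; aPos; aY; aPos] ++ writes (read_label t) ++
  (writes (add_arc aU aY) ++ writes (add_arc aY aU) ++ [:: aE]) by [].
apply: notin_cat; first exact: notin_all na _.
apply: notin_cat; last exact: notin_all na _.
by apply: writes_read_label; apply: notin_all na _.
Qed.

Lemma writes_sweep t (a b : nat) f k :
  a \notin [:: b; aQU; aQB; aD; aQH; aQT; aU; aB; aZ; aA; aY; aW] ->
  a \notin writes (bfs t ;; Fill b f k ;; erase t).
Proof.
move=> na.
have -> : writes (bfs t ;; Fill b f k ;; erase t) =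
  writes (bfs t) ++ writes (Fill b f k) ++ writes (erase t) by [].
move: (na); rewrite inE negb_or => /andP[a_ne_b na'].
apply: notin_cat; first exact: notin_all na' _.
by apply: notin_cat; [exact: writes_Fill | exact: notin_all na' _].
Qed.

Section Optimum.

Variables (t n m : nat) (I : instance t n m).
Notation big := (max_value t n m).

(** For positive [z] the two bounds squeeze the minimum to [big - z]. For [z] = 0 a feasible set
    would have size at least [big], which exceeds [m]. *)
Lemma opt_valueE z :
  (0 < z -> exists2 J, feasible I J & #|J| + z <= big) ->
  (forall J, feasible I J -> big <= z + #|J|) ->
  opt_value I = if 0 < z then Some (big - z) else None.
Proof.
move=> snd cpl; rewrite /opt_value; case: pickP => [J0 fJ0 | none].
  have lt_m : #|J0| < big.
    have le_m : #|J0| <= m by rewrite -[X in _ <= X]card_ord max_card.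
    by rewrite /max_value addn1 ltnS (leq_trans le_m) // leq_addl.
  have z_gt0 : 0 < z by have := cpl _ fJ0; lia.
  rewrite z_gt0; case: arg_minnP => // J fJ minJ; congr Some.
  have [J1 fJ1 le_J1] := snd z_gt0.
  by have := minJ _ fJ1; have := cpl _ fJ; lia.
by case: posnP => // /snd[J]; rewrite none.
Qed.

Lemma feasible_join J : feasible I J = is_join I J && (weight I J == target I).
Proof. by []. Qed.

End Optimum.

Section Main.

Variables (t n m : nat) (I : instance t n m) (w : nat).
Notation K := (nlab t).
Notation G := (lab t).
Notation big := (max_value t n m).
Hypothesis fits : K * K + 2 * big + m * (t + 2) + t + 10 < 2 ^ w.

(** The last clause speaks of every [F] above the initial row and closed under the cycle row, since
    the actual final row is only computed by the epilogue. *)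
Definition tables_done (s : memory) : Prop :=
  [/\ s aTgt 0 = rk (target I : G) /\ s aOut 0 = 0, s aBig 0 = big,
      sound_row I s aF [in terminals I], sound_row I s aC xpred0 &
      forall F : G -> nat, (forall g, s aF (rk g) <= F g) ->
        (forall x y, F (x +v y) + s aC (rk y) <= F x + big) ->
        forall J, is_join I J -> big <= F (weight I J) + #|J|].

Lemma runs_epilogue s :
  tables_done s ->
  runs w (epilogue t) s (fun c s' => c <= maxcost (epilogue t) /\ output s' = opt_value I).
Proof.
have lf : loopfree (combines t K).
  by elim: (nlab t) => //= k ->; exact: loopfree_Fill.
move=> [[sT s0] sB sndF sndC cpl]; apply: runs_loopfree => [|c le_c]; first by rewrite /= lf.
split=> //.
have [sndK leK rel fr] := run_combines fits (leqnn K) sB sndC sndF.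
rewrite /epilogue [run _ _ _]/=.
move: (run w (combines t K) s) sndK leK rel fr => s1 sndK leK rel fr.
rewrite !mod0n (fr aTgt) // sT.
have le_z := sound_row_le (target I : G) sndK.
set z := s1 (aF + K) (rk (target I : G)) in le_z *.
have snd_z : 0 < z -> exists2 J, feasible I J & #|J| + z <= big.
  move=> /sndK[J [pJ wJ le_J]]; exists J => //.
  by rewrite feasible_join wJ eqxx andbT; apply/is_joinP => v; rewrite pJ.
have cpl_z J : feasible I J -> big <= z + #|J|.
  rewrite feasible_join => /andP[jJ /eqP wJ].
  have := cpl (fun g => s1 (aF + K) (rk g)) leK _ J jJ; rewrite wJ; apply.
  move=> x y; have := rel _ (rk_lt y) x.
  by rewrite rkK (fr aC).
rewrite (opt_valueE snd_z cpl_z) /output.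
have out0 : s1 aOut 0 = 0 by rewrite fr // s0.
have [z0 | z_gt0] := posnP z; first by rewrite out0.
rewrite /update /= (fr aBig) // sB (const1 fits) modn_small ?addn1 //.
by move: fits; rewrite /max_value; lia.
Qed.

Hypothesis terminals_le2 : #|terminals I| <= 2.

(** The factors come from K (2 m) + 1 <= (2 K + 1) m and n + 1 <= 2 n, valid once there is an
    edge. *)
Definition main_cost : nat :=
  20 + 2 * edge_cost t + (2 * K + 1) * terminal_cost t + 2 * (2 * K + 1) * sweep_cost t.

Lemma init_row_sound s :
  (forall g : G, s aF (rk g) = if (#|terminals I| == 0) && (g == gzero) then big else 0) ->
  sound_row I s aF [in terminals I].
Proof.
move=> sF g; rewrite sF; case: ifP => // /andP[/eqP T0 /eqP ->] _.
exists set0; rewrite weight0 cards0; split=> // v.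
by rewrite par0 (cards0_eq T0) in_set0.
Qed.

(** With two terminals, [trail] bounds F at the weight of a trail between them, and [even_complete]
    passes from there to the weight of the whole join; without terminals the join itself is even. *)
Lemma joins_bounded (F C : G -> nat) (J : {set 'I_m}) :
  (forall x y, F (x +v y) + C y <= F x + big) ->
  (forall v, exists2 D, good_table I big v D & forall g, D v g <= C g) ->
  (#|terminals I| = 0 -> big <= F gzero) ->
  (#|terminals I| = 2 -> exists u v, terminals I =i (fun x => (x == u) (+) (x == v)) /\
     exists2 D, good_table I big u D & forall g, D v g <= F g) ->
  is_join I J -> big <= F (weight I J) + #|J|.
Proof.
move=> clF hC hF0 hF2 /is_joinP pJ.
have : #|terminals I| != 1.
  apply: contraFneq (even_card_odd I J) => T1; rewrite (eq_card (B := terminals I)) ?T1 // => v.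
  by rewrite inE pJ.
move: terminals_le2; rewrite leq_eqVlt => /orP[/eqP /hF2[u [v [Tuv [D [D0 clD _] leD]]]] _ | ].
  have [|P [sP pP leP]] := @trail _ _ _ I D J u v gzero clD; first by move=> x; rewrite pJ Tuv.
  rewrite gadd0r D0 in leP.
  have := even_complete (weight I P) clF hC pP.
  rewrite weightD // gaddC gaddvK.
  have := cardsID P J; rewrite (setIidPr sP); have := leD (weight I P); move: leP.
  have arith (d f1 f2 p j j' : nat) :
    big <= d + p -> d <= f1 -> p + j' = j -> f1 <= f2 + j' -> big <= f2 + j by lia.
  exact: arith.
case card_T : #|terminals I| => [|[|//]] // _ _.
have := even_complete gzero clF hC (_ : par I J =1 xpred0).
rewrite gadd0r => le_J; apply: leq_trans (hF0 card_T) (le_J _) => v.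
by rewrite pJ (cards0_eq card_T) in_set0.
Qed.

Lemma runs_tables :
  runs w (If (Read aIn (Const 1))
    (add_edges t ;;
     If (Defs.Sub (Read aIn (Const 2)) (Const 1)) (terminal_sweep t) Skip ;;
     sweeps t) Skip) (run w (prologue t) (initial (encode I)))
  (fun c s => c <= main_cost * (m * n + 1) /\ tables_done s).
Proof.
have [[sI sums sP sT sB] [sF s0]] := run_prologue fits terminals_le2.
move: (run w (prologue t) _) sI sums sP sT sB sF s0 => s sI sums sP sT sB sF s0.
have i1 : inp I 1 = m by [].
have i2 : inp I 2 = #|terminals I| by [].
have i0 : inp I 0 = n by [].
have sndF := init_row_sound sF.
apply: runs_if => /=; rewrite (const1 fits) sI i1; last first.
  (* Without edges the only candidate is the empty set, and the row left by the prologue already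
     accounts for it. *)
  move=> m0; apply: runs_loopfree => // c le_c; change (run w Skip s) with s; split.
    have : main_cost <= main_cost * (m * n + 1) by rewrite addn1 leq_pmulr.
    by move: le_c; rewrite /main_cost /=; lia.
  have all0 (J : {set 'I_m}) : J = set0.
    by apply/setP => e; move: (leq_ltn_trans (leq0n e) (ltn_ord e)); rewrite {1}m0.
  split; [by rewrite sT s0 | exact: sB | exact: sndF | by move=> g; rewrite s0 | ].
  move=> F leF _ J /is_joinP pJ.
  have T0 : #|terminals I| = 0.
    by apply: eq_card0 => v; rewrite -pJ (all0 J) par0.
  rewrite (all0 J) weight0 cards0 addn0.
  by have := leF gzero; rewrite sF T0 !eqxx.
move=> m_n0; have m_gt0 : 0 < m by rewrite lt0n.
pose e0 := Ordinal m_gt0.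
(* Hence m <= m n, which absorbs the time for reading the edges and for the search from a
   terminal. *)
have n_gt0 : 0 < n by exact: leq_ltn_trans (leq0n _) (ltn_ord (ends I e0).1).
have start : reading I e0 (inp I) (base I) s 0.
  rewrite /reading muln0 mul0n addn0.
  split; [exact: sI | exact: sums | | by rewrite s0 | by rewrite s0].
  by split=> [u | a]; [rewrite s0 | case: a].
have base_le : base I <= t + 5 by rewrite /base; lia.
apply: runs_seq.
apply: (runs_conseq (runs_frame (runs_add_edges fits i1 (@inp_edge _ _ _ I) base_le start))).
move=> c1 s1 [[le_c1 [sI1 sums1 arcs1 _ _]] fr1].
pose graph := rep_graph (n := n) m (asrc I e0) (ato I e0) (alab I e0) (2 * m).
have gr1 : graph s1 by split=> //; rewrite fr1 ?writes_add_edges.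
have tab1 : rep_table s1 (fun _ : 'I_n * G => 0).
  by move=> v g; rewrite fr1 ?writes_add_edges // s0.
pose volume := (K * (2 * m)).+1.
apply: runs_seq.
apply: (@runs_conseq _ _ _ (fun c s' => c <= terminal_cost t * volume + 10 /\
  [/\ graph s', rep_table s' (fun _ : 'I_n * G => 0),
    forall a, a \in [:: aIn; aOut; aTgt; aC] -> s' a =1 s1 a,
    sound_row I s' aF [in terminals I] &
    (#|terminals I| = 0 -> s' aF (rk (@gzero t)) = big) /\
    (#|terminals I| = 2 -> exists u v, terminals I =i (fun x => (x == u) (+) (x == v)) /\
      exists2 D, good_table I big u D & forall g, D v g <= s' aF (rk g))])).
  have aF1 (g : G) : s1 aF (rk g) = s aF (rk g) by rewrite fr1 ?writes_add_edges.
  apply: runs_if => /=; rewrite (const1 fits) (const_mod fits (k := 2)) // sI1 i2 => card_T.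
    have T2 : #|terminals I| = 2 by move: card_T terminals_le2; lia.
    have [u [v [Tuv _ i3 i4]]] := two_terminals T2.
    have s1u : s1 aIn 3 = u by rewrite sI1.
    have s1v : s1 aIn 4 = v by rewrite sI1.
    apply: (runs_conseq (runs_frame (runs_terminal_sweep fits gr1 tab1 s1u s1v))).
    move=> c2 s2 [[le_c2 [gr2 tab2 [D good eqD]]] fr2].
    split; first by rewrite /volume; lia.
    split=> //.
    - move=> a a_in; apply: fr2.
      rewrite [writes _](_ : _ = [:: aV] ++ writes (bfs t ;; copy_distances t ;; erase t)) //.
      by apply: notin_cat; [| apply: writes_sweep]; move: a a_in; apply/allP.
    - move=> g; rewrite eqD => pos; case: good => _ _ /(_ _ _ pos).
      by apply: eq_realizes => x; rewrite Tuv.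
    - split=> [T0 | _]; first by rewrite T0 in T2.
      by exists u, v; split=> //; exists D => // g; rewrite eqD.
  apply: runs_loopfree => // c2 le_c2; change (run w Skip s1) with s1.
  split; first by move: le_c2 => /=; lia.
  split=> //; first by move=> g; rewrite aF1; exact: sndF.
  split=> [T0 | T2]; first by rewrite aF1 sF T0 !eqxx.
  by move: card_T; rewrite T2.
move=> c2 s2 [le_c2 [gr2 tab2 fr2 sndF2 [T0F T2F]]].
have sI2 i : s2 aIn i = inp I i by rewrite fr2 ?sI1.
have sC2 (g : G) : s2 aC (rk g) = 0 by rewrite fr2 // fr1 ?writes_add_edges // s0.
have sn2 : s2 aIn 0 = n by rewrite sI2.
apply: (runs_conseq (runs_frame (runs_sweeps fits gr2 tab2 sn2 sC2))).
move=> c3 s3 [[le_c3 [sndC cyc]] fr3].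
have fr3' a : a \in [:: aOut; aTgt; aBig; aF] -> s3 a =1 s2 a.
  move=> a_in; apply: fr3.
  rewrite [writes _](_ : _ =
    [:: aV] ++ (writes (bfs t ;; improve_cycles t ;; erase t) ++ [:: aV])) //.
  by do 2?apply: notin_cat; try apply: writes_sweep; move: a a_in; apply/allP.
split.
  have le_m : m <= m * n by rewrite leq_pmulr.
  have le_v : volume <= (2 * K + 1) * m by rewrite /volume; have := m_gt0; lia.
  have le_v1 : volume <= (2 * K + 1) * (m * n).
    by apply: leq_trans le_v _; rewrite leq_mul2l le_m orbT.
  have le_v2 : n.+1 * volume <= 2 * (2 * K + 1) * (m * n).
    have -> : 2 * (2 * K + 1) * (m * n) = (2 * n) * ((2 * K + 1) * m) by lia.
    by apply: leq_mul le_v; lia.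
  have le1 : edge_cost t * m.+1 <= edge_cost t * (2 * (m * n)).
    by rewrite leq_mul2l; apply/orP; right; lia.
  have le2 : terminal_cost t * volume <= terminal_cost t * ((2 * K + 1) * (m * n)).
    by rewrite leq_mul2l le_v1 orbT.
  have le3 : sweep_cost t * (n.+1 * volume) <= sweep_cost t * (2 * (2 * K + 1) * (m * n)).
    by rewrite leq_mul2l le_v2 orbT.
  have := leq_trans le_c1 le1; have := leq_trans le_c3 le3; move: le_c2 le2.
  rewrite /main_cost; move: (terminal_cost t * volume) => tv.
  have arith e p q z k : c2 <= tv + 10 -> tv <= p * (k * z) -> c3 <= q * (2 * k * z) ->
    c1 <= e * (2 * z) -> 0 < z ->
    (2 + (c1 + (c2 + c3))).+1 <= (20 + 2 * e + k * p + 2 * k * q) * (z + 1) by lia.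
  by move=> *; apply: arith => //; rewrite muln_gt0 m_gt0.
split.
- by rewrite !fr3' // !fr2 // !fr1 ?writes_add_edges // sT s0.
- by rewrite fr3' //; case: gr2.
- by move=> g; rewrite fr3' //; exact: sndF2.
- exact: sndC.
- move=> F leF clF J; apply: joins_bounded clF _ _ _.
  + by move=> v; exact: cyc.
  + by move=> /T0F <-; rewrite -(fr3' aF).
  + move=> /T2F[u [v [Tuv [D good leD]]]]; exists u, v; split=> //.
    by exists D => // g; apply: leq_trans (leD g) _; rewrite -(fr3' aF).
Qed.

End Main.

(** * Word size and total time *)

Definition word_factor (t : nat) : nat :=
  nlab t * nlab t + 2 * nlab t + 2 * t + 20.

(** With L the factor and x = n + m + 2 >= 2, the left side is at most L x, and L < 2^L <= x^L gives
    L x < x^(L + 1) <= 2^w. So O(log x) bits suffice. *)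
Lemma word_fits t n m w :
  (word_factor t).+1 * up_log 2 (n + m + 2) <= w ->
  nlab t * nlab t + 2 * max_value t n m + m * (t + 2) + t + 10 < 2 ^ w.
Proof.
move=> le_w; set L := word_factor t in le_w; set x := n + m + 2 in le_w.
have le_x : x ^ L.+1 <= 2 ^ w.
  apply: leq_trans (_ : (2 ^ up_log 2 x) ^ L.+1 <= _); first by rewrite leq_exp2r // up_logP.
  by rewrite -expnM leq_exp2l // mulnC.
apply: leq_ltn_trans (_ : L * x < 2 ^ w).
  by rewrite /L /x /word_factor /max_value; move: (nlab t) => k; nia.
apply: leq_trans le_x; rewrite expnSr ltn_pmul2r; last by rewrite /x; lia.
apply: leq_trans (ltn_expl L (isT : 1 < 2)) _.
by rewrite leq_exp2r; [rewrite /x; lia | rewrite /L /word_factor; lia].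
Qed.

Theorem theorem6p4 (t : nat) :
  exists (P : cmd) (c C : nat),
    forall (n m : nat) (I : instance t n m),
      #|terminals I| <= 2 ->
      forall w : nat, c * up_log 2 (n + m + 2) <= w ->
      exists (k : nat) (s : memory),
        [/\ exec w P (initial (encode I)) k s,
            k <= C * (m * n + 1)
          & output s = opt_value I].
Proof.
exists (parity_join t), (word_factor t).+1.
exists (maxcost (prologue t) + main_cost t + maxcost (epilogue t)).
move=> n m I card_T w /(@word_fits t n m w) fits.
have lf_pro : loopfree (prologue t).
  by rewrite /= loopfree_Fill loopfree_coords.
suff [k [s [x [le_k out]]]] : runs w (parity_join t) (initial (encode I)) (fun k s =>
    k <= (maxcost (prologue t) + main_cost t + maxcost (epilogue t)) * (m * n + 1) /\
    output s = opt_value I) by exists k, s.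
apply: runs_seq; apply: runs_loopfree => // k1 le1.
apply: runs_seq; apply: (runs_conseq (runs_tables fits card_T)) => k2 s2 [le2 done2].
apply: (runs_conseq (runs_epilogue fits done2)) => k3 s3 [le3 out]; split=> //.
have mono j : j <= j * (m * n + 1) by rewrite leq_pmulr // addn1.
have h1 := leq_trans le1 (mono _); have h3 := leq_trans le3 (mono _).
have arith a b c z : k1 <= a * z -> k2 <= b * z -> k3 <= c * z ->
  k1 + (k2 + k3) <= (a + b + c) * z by rewrite !mulnDl; lia.
exact: arith.
Qed.
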